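(* Let $G$ be a finite group and let $Z$ be the two-dimensional Dijkgraaf--Witten theory of $G$. Then $Z(S^1)$ is the space $C_{\mathrm{class}}(G)$ of complex class functions on $G$, with basis $\{e_\alpha\}$ indexed by conjugacy classes $\alpha$ of $G$, and: (i) the metric (cylinder) is $g_{\alpha\beta}=\delta_{\alpha,\beta^{-1}}\frac{|\alpha|}{|G|}$; (ii) the three-point function (trinion) is $Z_{\alpha\beta\gamma}=\frac1{|G|}\,\bigl|\{(g_1,g_2,g_3)\in\alpha\times\beta\times\gamma: g_1g_2g_3=1\}\bigr|$, and the multiplication $e_\alpha e_\beta=\sum_\gamma Z_{\alpha\beta}^{\gamma}e_\gamma$, with $Z_{\alpha\beta}^\gamma=\sum_\kappa g^{\kappa\gamma}Z_{\alpha\beta\kappa}$, is given by $Z_{\alpha\beta}^\gamma=|\{h\in\beta: gh^{-1}\in\alpha\}|$ for any $g\in\gamma$; (iii) the unit is $e_{\{1\}}$, and the Frobenius form (disc) is $\epsilon(e_\alpha)=\frac1{|G|}\delta_{\alpha,\{1\}}$. Consequently $Z(S^1)$ carries the same Frobenius algebra structure as $C_{\mathrm{class}}(G)$ with the convolution product $(f*f')(g)=\sum_{h\in G}f(h)f'(h^{-1}g)$ and Frobenius form $\epsilon(f)=\frac1{|G|}f(1)$.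
   Context: For a closed 1-manifold $\Sigma$, $Z(\Sigma)$ is the space of complex functions on the finite set of isomorphism classes of principal $G$-bundles over $\Sigma$. Bundles over an oriented circle are classified by the conjugacy class of their holonomy; $e_\alpha$ is the function with value $1$ on the bundle class with holonomy $\alpha$ and $0$ elsewhere. For a compact oriented surface $M$ with boundary and a bundle $Q$ on $\partial M$ (boundary circles carrying the induced orientation), $$Z(M)(Q)=\sum_{P}\frac1{|\mathrm{Aut}(P)|},$$ the sum running over isomorphism classes of principal $G$-bundles $P\to M$ whose restriction to $\partial M$ is isomorphic to $Q$. If $\partial M$ is a union of $k$ circles this is written $Z_{\alpha_1\cdots\alpha_k}$. The metric $g_{\alpha\beta}$ is $Z_{\alpha\beta}$ for the cylinder $S^1\times[0,1]$, and $g^{\alpha\beta}$ is its inverse matrix. Indices corresponding to output circles are raised with $g^{\alpha\beta}$. The multiplication comes from the trinion (sphere minus three discs) with two inputs and one output, the unit from the disc with its boundary as output, and the form $\epsilon$ from the disc with its boundary as input. Here $\alpha^{-1}=\{g^{-1}:g\in\alpha\}$. *)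

(* Defs.v *)
(* The real numbers are [R : realType], the complex numbers [R[i]]. *)
From HB Require Import structures.
From mathcomp Require Import all_boot all_order all_algebra all_fingroup.
From mathcomp Require Import complex finmap.
From mathcomp Require Import all_classical all_reals all_analysis.
From mathcomp Require Import ring lra.
Set Implicit Arguments.
Unset Strict Implicit.
Unset Printing Implicit Defensive.
Import Order.TTheory GRing.Theory Num.Theory.
Import numFieldNormedType.Exports.

Local Open Scope classical_set_scope.
Local Open Scope ring_scope.

Lemma continuous_pair (T U V : topologicalType) (f : T -> U) (g : T -> V) x :
  {for x, continuous f} -> {for x, continuous g} ->
  {for x, continuous (fun y => (f y, g y))}.
Proof. by move=> cf cg; exact: cvg_pair. Qed.

Section PrincipalBundles.
Variable gT : finGroupType.

(* [phi] is an equivariant homeomorphism pi^-1(U) -> U x G over U with inverse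
   [psi], where G is discrete and acts on U x G by right translation. As U and
   pi^-1(U) are open, continuity on them is continuity at each of their
   points in the ambient space. *)
Definition trivialises (B P : topologicalType) (pi : P -> B)
    (act : P -> gT -> P) (U : set B)
    (phi : P -> B * discrete_topology gT)
    (psi : B * discrete_topology gT -> P) : Prop :=
  [/\ (forall p, U (pi p) -> {for p, continuous phi}) /\
        (forall x, U x.1 -> {for x, continuous psi}),
      forall p, U (pi p) -> (phi p).1 = pi p,
      forall p g, U (pi p) -> (phi (act p g)).2 = ((phi p).2 * g)%g,
      forall p, U (pi p) -> psi (phi p) = p &
      forall x, U x.1 -> pi (psi x) = x.1 /\ phi (psi x) = x].

Record pbundle (B : topologicalType) := PBundle {
  total :> topologicalType;
  proj : total -> B;
  pact : total -> gT -> total;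
  pact1 : forall p, pact p 1%g = p;
  pactM : forall p g h, pact p (g * h)%g = pact (pact p g) h;
  proj_continuous : continuous proj;
  pact_continuous : forall g, continuous (fun p => pact p g);
  proj_pact : forall p g, proj (pact p g) = proj p;
  locally_trivial : forall b, exists U phi psi,
    [/\ open U, U b & trivialises proj pact U phi psi]
}.

Definition bundle_iso (B : topologicalType) (P Q : pbundle B) (f : P -> Q) : Prop :=
  [/\ continuous f,
      forall p, proj (f p) = proj p,
      forall p g, f (pact p g) = pact (f p) g &
      exists f' : Q -> P, [/\ continuous f', cancel f f' & cancel f' f]].

Definition isomorphic (B : topologicalType) (P Q : pbundle B) : Prop :=
  exists f : P -> Q, bundle_iso f.

Definition Aut_bundle (B : topologicalType) (P : pbundle B) : set (P -> P) :=
  [set f | bundle_iso f].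
Arguments Aut_bundle [B] P.

(* 0 if the automorphism group is infinite *)
Definition card_Aut (B : topologicalType) (P : pbundle B) : nat :=
  #|` fset_set (Aut_bundle P)|%fset.

Section Pullback.
Variables (A B : topologicalType) (f : A -> B) (cf : continuous f).
Variable P : pbundle B.

Definition pullback_set : set (A * P) := [set x | f x.1 = proj x.2].

Definition pullback_total : topologicalType := set_type pullback_set.

Definition pullback_proj (x : pullback_total) : A := (\val x).1.

Lemma pullback_act_subproof (x : pullback_total) (g : gT) :
  ((\val x).1, pact (\val x).2 g) \in pullback_set.
Proof.
by apply/mem_set; rewrite /pullback_set/= proj_pact; exact: (set_mem (valP x)).
Qed.

Definition pullback_act (x : pullback_total) (g : gT) : pullback_total :=
  exist (fun z => z \in pullback_set) _ (pullback_act_subproof x g).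

Lemma pullback_act1 x : pullback_act x 1%g = x.
Proof. by apply: val_inj; rewrite /= pact1 -surjective_pairing. Qed.

Lemma pullback_actM x g h :
  pullback_act x (g * h)%g = pullback_act (pullback_act x g) h.
Proof. by apply: val_inj; rewrite /= pactM. Qed.

Lemma pullback_val_continuous :
  continuous (fun x : pullback_total => \val x : A * P).
Proof. exact: initial_continuous. Qed.

Lemma pullback_proj_continuous : continuous pullback_proj.
Proof.
move=> x; apply: (@continuous_comp _ _ _ (fun x : pullback_total => \val x) fst).
  exact: pullback_val_continuous.
exact: cvg_fst.
Qed.

Lemma pullback_snd_continuous :
  continuous (fun x : pullback_total => (\val x).2).
Proof.
move=> x; apply: (@continuous_comp _ _ _ (fun x : pullback_total => \val x) snd).
  exact: pullback_val_continuous.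
exact: cvg_snd.
Qed.

Lemma pullback_act_continuous g : continuous (fun x => pullback_act x g).
Proof.
apply: (@continuous_comp_initial _ _ _ (fun x : pullback_total => \val x)).
move=> x; apply: (@continuous_pair _ _ _ pullback_proj
  (fun x : pullback_total => pact (\val x).2 g)).
  exact: pullback_proj_continuous.
apply: (@continuous_comp _ _ _ (fun x : pullback_total => (\val x).2)
  (fun p => pact p g)).
  exact: pullback_snd_continuous.
exact: pact_continuous.
Qed.

Lemma pullback_locally_trivial a : exists U phi psi,
  [/\ open U, U a & trivialises pullback_proj pullback_act U phi psi].
Proof.
have [U [phi [psi [oU Ua [[cphi cpsi] phi1 phiM phiK psiK]]]]] :=
  locally_trivial P (f a).
have [pa _] := psiK (f a, 1%g : discrete_topology gT) Ua.
have ax : (a, psi (f a, 1%g : discrete_topology gT)) \in pullback_set.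
  by apply/mem_set; rewrite /pullback_set/= pa.
pose x0 : pullback_total := exist (fun z => z \in pullback_set) _ ax.
have pullbackE (x : pullback_total) : proj (\val x).2 = f (\val x).1.
  by have := set_mem (valP x); rewrite /pullback_set/= => ->.
have in_pb (y : A * discrete_topology gT) : U (f y.1) ->
    (y.1, psi (f y.1, y.2)) \in pullback_set.
  by move=> Uy; apply/mem_set; rewrite /pullback_set/=; have [-> _] := psiK (f y.1, y.2) Uy.
exists (f @^-1` U).
exists (fun x => (pullback_proj x, (phi (\val x).2).2)).
exists (fun y => insubd x0 (y.1, psi (f y.1, y.2))).
split => //; first by apply: open_comp => // y _; exact: cf.
split.
- split=> [x Ux|y Uy].
    apply: continuous_pair; first exact: pullback_proj_continuous.
    apply: (@continuous_comp _ _ _ (fun x : pullback_total => (\val x).2)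
      (fun p => (phi p).2)); first exact: pullback_snd_continuous.
    apply: (@continuous_comp _ _ _ phi snd); last exact: cvg_snd.
    by apply: cphi; rewrite pullbackE.
  have cy : {for y, continuous
      (fun y : A * discrete_topology gT => (y.1, psi (f y.1, y.2)))}.
    apply: continuous_pair; first exact: cvg_fst.
    apply: (@continuous_comp _ _ _
      (fun y : A * discrete_topology gT => (f y.1, y.2)) psi).
      apply: continuous_pair; last exact: cvg_snd.
      by apply: (@continuous_comp _ _ _ fst f); [exact: cvg_fst|exact: cf].
    exact: cpsi.
  move=> N; rewrite nbhsE /= => -[V [[W oW <-] VW] VN].
  rewrite /preimage/= in VW.
  have nW : nbhs (y.1, psi (f y.1, y.2)) W.
    apply: open_nbhs_nbhs; split => //.
    by move: VW; rewrite -[set_val _]/(\val _) val_insubd (in_pb y Uy).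
  have nU : nbhs y [set z : A * discrete_topology gT | U (f z.1)].
    apply: open_nbhs_nbhs; split => //.
    apply: (@open_comp _ _ (fun z : A * discrete_topology gT => f z.1)) => //.
    move=> z _; apply: (@continuous_comp _ _ _ fst f); first exact: cvg_fst.
    exact: cf.
  have nW' : nbhs y [set z : A * discrete_topology gT |
    W (z.1, psi (f z.1, z.2))] := cy _ nW.
  change (nbhs y [set z : A * discrete_topology gT |
    N (insubd x0 (z.1, psi (f z.1, z.2)))]).
  apply: filterS (filterI nU nW') => z [Uz Wz].
  by apply: VN; rewrite /preimage/= -[set_val _]/(\val _) val_insubd in_pb.
- by [].
- by move=> x g Ux /=; apply: phiM; rewrite pullbackE.
- move=> x Ux; apply: val_inj; rewrite val_insubd in_pb//=.
  rewrite /pullback_proj -pullbackE -phi1 ?pullbackE// -surjective_pairing.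
  by rewrite phiK ?pullbackE// -surjective_pairing.
- move=> y Uy; have [p1 p2] := psiK (f y.1, y.2) Uy.
  rewrite /pullback_proj val_insubd in_pb//=; split => //.
  by rewrite p2/= -surjective_pairing.
Qed.

Definition pullback : pbundle A :=
  @PBundle A pullback_total pullback_proj pullback_act
    pullback_act1 pullback_actM pullback_proj_continuous pullback_act_continuous
    (fun _ _ => erefl) pullback_locally_trivial.

End Pullback.

End PrincipalBundles.

Section Surfaces.
Variable R : realType.

(* The unit circle of R^2, oriented counterclockwise. *)
Definition circle_set : set (R * R) := [set z | z.1 ^+ 2 + z.2 ^+ 2 = 1].

Definition circle : topologicalType := set_type circle_set.

Lemma circleE (z : circle) : (\val z).1 ^+ 2 + (\val z).2 ^+ 2 = 1.
Proof. exact: (set_mem (valP z)). Qed.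

Lemma circle_loop_subproof (t : R) :
  (cos (2 * pi * t), sin (2 * pi * t)) \in circle_set.
Proof. by apply/mem_set; rewrite /circle_set/= cos2Dsin2. Qed.

Definition circle_loop (t : R) : circle :=
  exist (fun z => z \in circle_set) _ (circle_loop_subproof t).

Lemma circle_conj_subproof (z : circle) :
  ((\val z).1, - (\val z).2) \in circle_set.
Proof. by apply/mem_set; rewrite /circle_set/= sqrrN circleE. Qed.

Definition circle_conj (z : circle) : circle :=
  exist (fun z => z \in circle_set) _ (circle_conj_subproof z).

Lemma circle_fst_continuous : continuous (fun z : circle => (\val z).1).
Proof.
move=> z; apply: (@continuous_comp _ _ _ (fun z : circle => \val z) fst).
  exact: initial_continuous.
exact: cvg_fst.
Qed.

Lemma circle_snd_continuous : continuous (fun z : circle => (\val z).2).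
Proof.
move=> z; apply: (@continuous_comp _ _ _ (fun z : circle => \val z) snd).
  exact: initial_continuous.
exact: cvg_snd.
Qed.

Lemma circle_conj_continuous : continuous circle_conj.
Proof.
apply: (@continuous_comp_initial _ _ _ (fun z : circle => \val z)) => z.
apply: (@continuous_pair _ _ _ (fun z : circle => (\val z).1)
  (fun z : circle => - (\val z).2)); first exact: circle_fst_continuous.
apply: (@continuous_comp _ _ _ (fun z : circle => (\val z).2) -%R).
  exact: circle_snd_continuous.
exact: opp_continuous.
Qed.

(* Disjoint union of k circles. *)
Definition circles (k : nat) : topologicalType := {i : 'I_k & circle}.

(* A space M with a parametrisation of each circle of its boundary. For an
   oriented surface the i-th parametrisation is to carry the counterclockwise
   orientation of [circle] to the orientation induced on the i-th boundary
   component. These data are all that Z(M) depends on. *)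
Record bordered := Bordered {
  carrier :> topologicalType;
  nb_circles : nat;
  bcircle : 'I_nb_circles -> circle -> carrier;
  bcircle_continuous : forall i, continuous (bcircle i)
}.

Definition boundary (M : bordered) : topologicalType := circles (nb_circles M).

Definition boundary_map (M : bordered) : boundary M -> M :=
  fun x => bcircle (projT1 x) (projT2 x).

Lemma boundary_map_continuous (M : bordered) : continuous (@boundary_map M).
Proof.
by apply: (@sigT_continuous _ _ _ (@bcircle M)) => i; exact: bcircle_continuous.
Qed.

(* The closed unit disc. *)
Definition disc_set : set (R * R) := [set z | z.1 ^+ 2 + z.2 ^+ 2 <= 1].

Lemma circle_disc_subproof (z : circle) : \val z \in disc_set.
Proof. by apply/mem_set; rewrite /disc_set/= circleE. Qed.

Definition disc_of_circle (z : circle) : disc_set :=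
  exist (fun z => z \in disc_set) _ (circle_disc_subproof z).

Lemma disc_of_circle_continuous : continuous disc_of_circle.
Proof.
apply: (@continuous_comp_initial _ _ _ (fun z : disc_set => \val z)).
exact: initial_continuous.
Qed.

Definition disc : bordered :=
  @Bordered disc_set 1 (fun _ => disc_of_circle)
    (fun _ => disc_of_circle_continuous).

(* The cylinder circle * [0, 1] with the product orientation: the induced
   orientations of the two ends are opposite. *)
Definition unit_interval : set R := `[0, 1].

Lemma unit_interval0 : (0 : R) \in unit_interval.
Proof. by apply/mem_set; rewrite /unit_interval/= in_itv/= lexx ler01. Qed.

Lemma unit_interval1 : (1 : R) \in unit_interval.
Proof. by apply/mem_set; rewrite /unit_interval/= in_itv/= lexx ler01. Qed.

Definition cylinder_space : topologicalType := (circle * unit_interval)%type.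

Definition cylinder_circle (i : 'I_2) (z : circle) : cylinder_space :=
  if i == ord0 then (z, exist (fun t => t \in unit_interval) 0 unit_interval0)
  else (circle_conj z, exist (fun t => t \in unit_interval) 1 unit_interval1).

Lemma cylinder_circle_continuous i : continuous (cylinder_circle i).
Proof.
rewrite /cylinder_circle; case: eqP => _ z.
  by apply: continuous_pair; [exact: cvg_id|exact: cst_continuous].
apply: continuous_pair; first exact: circle_conj_continuous.
exact: cst_continuous.
Qed.

Definition cylinder : bordered :=
  @Bordered cylinder_space 2 cylinder_circle cylinder_circle_continuous.

(* The unit sphere of R^3 minus the three disjoint open discs (spherical caps)
   x > 4/5, x < -4/5 and y > 4/5. *)
Definition trinion_set : set (R * R * R) :=
  [set p | [/\ p.1.1 ^+ 2 + p.1.2 ^+ 2 + p.2 ^+ 2 = 1,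
               - (4 / 5) <= p.1.1 <= 4 / 5 & p.1.2 <= 4 / 5]].

(* With n the outward normal of the sphere and v pointing out of the trinion
   (into the missing disc), the induced orientation is that of n x v. *)
Definition trinion_point (i : 'I_3) (z : circle) : R * R * R :=
  let c := (\val z).1 in let s := (\val z).2 in
  if i == 0%N :> nat then (4 / 5, 3 / 5 * c, - (3 / 5 * s))
  else if i == 1%N :> nat then (- (4 / 5), 3 / 5 * c, 3 / 5 * s)
  else (3 / 5 * c, 4 / 5, 3 / 5 * s).

Lemma trinion_point_subproof i z : trinion_point i z \in trinion_set.
Proof.
apply/mem_set; rewrite /trinion_point.
have := circleE z; move: (\val z).1 (\val z).2 => c s cs.
have c_ge : -1 <= c by nra.
have c_le : c <= 1 by nra.
by case: ifP => _; [|case: ifP => _]; split => /=;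
  rewrite ?(sqrrN, exprMn) //; lra.
Qed.

Definition trinion_circle i z : trinion_set :=
  exist (fun p => p \in trinion_set) _ (trinion_point_subproof i z).

Lemma trinion_circle_continuous i : continuous (trinion_circle i).
Proof.
apply: (@continuous_comp_initial _ _ _ (fun p : trinion_set => \val p)).
have c1 (a : R) : continuous (fun z : circle => a * (\val z).1).
  move=> z; apply: (@continuous_comp _ _ _
    (fun z : circle => (\val z).1) ( *%R a)).
    exact: circle_fst_continuous.
  exact: mulrl_continuous.
have c2 (a : R) : continuous (fun z : circle => a * (\val z).2).
  move=> z; apply: (@continuous_comp _ _ _
    (fun z : circle => (\val z).2) ( *%R a)).
    exact: circle_snd_continuous.
  exact: mulrl_continuous.
have cN2 (a : R) : continuous (fun z : circle => - (a * (\val z).2)).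
  move=> z; apply: (@continuous_comp _ _ _
    (fun z : circle => a * (\val z).2) -%R); first exact: c2.
  exact: opp_continuous.
have cc (a : R) : continuous (fun z : circle => a) by move=> z; exact: cst_continuous.
have c3 (f g h : circle -> R) : continuous f -> continuous g ->
    continuous h -> continuous (fun z => (f z, g z, h z)).
  move=> cf cg ch z.
  apply: (@continuous_pair _ _ _ (fun z => (f z, g z)) h); last exact: ch.
  by apply: continuous_pair; [exact: cf|exact: cg].
rewrite /comp /= /trinion_point /=.
case: (nat_of_ord i == 0%N) => [|]; last case: (nat_of_ord i == 1%N) => [|].
- exact: (c3 _ _ _ (cc _) (c1 _) (cN2 _)).
- exact: (c3 _ _ _ (cc _) (c1 _) (c2 _)).
- exact: (c3 _ _ _ (c1 _) (cc _) (c2 _)).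
Qed.

Definition trinion : bordered :=
  @Bordered trinion_set 3 trinion_circle trinion_circle_continuous.

End Surfaces.

Section DijkgraafWitten.
Variables (R : realType) (gT : finGroupType).

Local Notation C := R[i].

Definition conj_class : finType :=
  {A : {set gT} | A \in classes [set: gT]%SET}.

Definition class_set (a : conj_class) : {set gT} := \val a.

(* [g] is a holonomy of P: a lift of the counterclockwise loop around the
   circle runs from some p to p g. *)
Definition has_holonomy (P : pbundle gT (circle R)) (g : gT) : Prop :=
  exists gamma : R -> P,
    [/\ {within `[0, 1], continuous gamma},
        forall t, 0 <= t <= 1 -> proj (gamma t) = circle_loop t &
        gamma 1 = pact (gamma 0) g].

Definition holonomy (P : pbundle gT (circle R)) : {set gT} :=
  [set g | `[< has_holonomy P g >]]%SET.

(* Z(B) for a closed 1-manifold B: the complex functions on isomorphism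
   classes of bundles. For universe reasons functions on the type of all bundles
   cannot carry the library's module structures, so Z(B) is a predicate on
   functions, with pointwise operations. *)
Definition Zspace (B : topologicalType) (phi : pbundle gT B -> C) : Prop :=
  forall P Q, isomorphic P Q -> phi P = phi Q.

Definition restriction (M : bordered R) (P : pbundle gT M) :
    pbundle gT (boundary M) :=
  pullback (@boundary_map_continuous R M) P.

(* [s] lists the bundles on M restricting to Q, once per isomorphism class. *)
Definition representatives (M : bordered R) (Q : pbundle gT (boundary M))
    (n : nat) (s : 'I_n -> pbundle gT M) : Prop :=
  [/\ forall i, isomorphic (restriction (s i)) Q,
      forall i j, isomorphic (s i) (s j) -> i = j &
      forall P, isomorphic (restriction P) Q -> exists i, isomorphic P (s i)].

(* The sum does not depend on the representatives. It would be 0 by convention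
   if there were infinitely many isomorphism classes. *)
Definition Z (M : bordered R) (Q : pbundle gT (boundary M)) : C :=
  xget 0 [set z | exists n (s : 'I_n -> pbundle gT M),
    representatives Q s /\ z = \sum_(i < n) ((card_Aut (s i))%:R)^-1].

Definition circle_restriction (k : nat) (i : 'I_k)
    (Q : pbundle gT (circles R k)) : pbundle gT (circle R) :=
  pullback (@existT_continuous _ (fun _ : 'I_k => circle R) i) Q.

(* The value of an element of Z(k circles) at the isomorphism class of bundles
   with holonomies [t]. *)
Definition value_at (k : nat) (phi : pbundle gT (circles R k) -> C)
    (t : k.-tuple conj_class) : C :=
  xget 0 [set z | exists Q : pbundle gT (circles R k),
    (forall i, holonomy (circle_restriction i Q) = class_set (tnth t i)) /\
    z = phi Q].

Definition Zindex (M : bordered R) (t : (nb_circles M).-tuple conj_class) : C :=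
  value_at (@Z M) t.

Definition metric (a b : conj_class) : C := @Zindex (cylinder R) [tuple a; b].

Definition metric_mx : 'M[C]_#|{: conj_class}| :=
  \matrix_(i, j) metric (enum_val i) (enum_val j).

Definition inv_metric (a b : conj_class) : C :=
  invmx metric_mx (enum_rank a) (enum_rank b).

Definition Z3 (a b c : conj_class) : C := @Zindex (trinion R) [tuple a; b; c].

Definition Z3_raised (a b c : conj_class) : C :=
  \sum_(k : conj_class) inv_metric k c * Z3 a b k.

Definition Z1 (a : conj_class) : C := @Zindex (disc R) [tuple a].

Definition Z1_raised (c : conj_class) : C :=
  \sum_(k : conj_class) inv_metric k c * Z1 k.

(* The function e_alpha of Z(S^1), for alpha = A. *)
Definition Ze (A : {set gT}) : pbundle gT (circle R) -> C :=
  fun P => (holonomy P == A)%:R.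

Definition coord (phi : pbundle gT (circle R) -> C) (a : conj_class) : C :=
  xget 0 [set z | exists P, holonomy P = class_set a /\ z = phi P].

(* Bilinear extension of e_a e_b = \sum_c Z_{ab}^c e_c. *)
Definition Zmul (phi psi : pbundle gT (circle R) -> C) :
    pbundle gT (circle R) -> C :=
  fun P => \sum_(a : conj_class) \sum_(b : conj_class) \sum_(c : conj_class)
    coord phi a * coord psi b * Z3_raised a b c * Ze (class_set c) P.

Definition Zone : pbundle gT (circle R) -> C :=
  fun P => \sum_(c : conj_class) Z1_raised c * Ze (class_set c) P.

(* Linear extension of e_a |-> Z_a. *)
Definition Zform (phi : pbundle gT (circle R) -> C) : C :=
  \sum_(a : conj_class) coord phi a * Z1 a.

Definition class_functions : {pred {ffun gT -> C^o}} :=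
  [pred f : {ffun gT -> C^o} | [forall x, forall y, f (x ^ y)%g == f x]].

Lemma class_functionP (f : {ffun gT -> C^o}) :
  reflect (forall x y, f (x ^ y)%g = f x) (f \in class_functions).
Proof.
apply: (iffP forallP) => [h x y|h x]; first by apply/eqP; move/forallP: (h x).
by apply/forallP => y; rewrite h.
Qed.

Lemma class_functions_closed : submod_closed class_functions.
Proof.
split; first by apply/class_functionP => x y; rewrite !ffunE.
move=> a f g /class_functionP cf /class_functionP cg.
by apply/class_functionP => x y; rewrite !ffunE cf cg.
Qed.

HB.instance Definition _ :=
  GRing.isSubmodClosed.Build C {ffun gT -> C^o} class_functions
    class_functions_closed.

Record class_fun :=
  ClassFun { cf_val :> {ffun gT -> C^o}; _ : cf_val \in class_functions }.

HB.instance Definition _ := [isSub for cf_val].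
HB.instance Definition _ := [Choice of class_fun by <:].
HB.instance Definition _ := [SubChoice_isSubLmodule of class_fun by <:].

Lemma class_funJ (f : class_fun) x y : f (x ^ y)%g = f x.
Proof. by have /class_functionP := valP f. Qed.

Lemma cf_conv_subproof (f f' : class_fun) :
  [ffun g => \sum_(h : gT) f h * f' (h^-1 * g)%g : C^o] \in class_functions.
Proof.
apply/class_functionP => x y; rewrite !ffunE (reindex_inj (conjg_inj y)) /=.
by apply: eq_bigr => h _; rewrite -conjVg -conjMg !class_funJ.
Qed.

Definition cf_conv (f f' : class_fun) : class_fun :=
  ClassFun (cf_conv_subproof f f').

Lemma cf_indicator_subproof (a : conj_class) :
  [ffun g => (g \in class_set a)%:R : C^o] \in class_functions.
Proof.
have aJ x y : x \in class_set a -> (x ^ y)%g \in class_set a.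
  rewrite /class_set; have /imsetP[z _ ->] := valP a => /imsetP[u _ ->].
  by rewrite -conjgM; apply: imset_f; rewrite inE.
apply/class_functionP => x y; rewrite !ffunE; congr (nat_of_bool _)%:R.
by apply/idP/idP => [/(aJ _ y^-1%g)|/aJ//]; rewrite conjgK.
Qed.

Definition cf_indicator (a : conj_class) : class_fun :=
  ClassFun (cf_indicator_subproof a).

Lemma class1_subproof : [set 1%g]%SET \in classes [set: gT]%SET.
Proof.
apply/imsetP; exists 1%g; first by rewrite inE.
by rewrite (class1G [set: gT]%G).
Qed.

Definition class1 : conj_class :=
  exist (fun A => A \in classes [set: gT]%SET) _ class1_subproof.

Definition cf_form (f : class_fun) : C := (#|gT|%:R)^-1 * f 1%g.

(* [repr] picks an element: f is evaluated at a holonomy of P. *)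
Definition Zof (f : class_fun) : pbundle gT (circle R) -> C :=
  fun P => f (repr (holonomy P)).

End DijkgraafWitten.

Definition Frobenius_algebra (K : fieldType) (A : lmodType K)
    (mul : A -> A -> A) (one : A) (eps : A -> K) : Prop :=
  [/\ (forall a x y z, mul (a *: x + y) z = a *: mul x z + mul y z) /\
        (forall a x y z, mul x (a *: y + z) = a *: mul x y + mul x z),
      associative mul /\ (left_id one mul /\ right_id one mul),
      forall a x y, eps (a *: x + y) = a * eps x + eps y,
      (exists n (v : 'I_n -> A), forall x, exists c : 'I_n -> K,
        x = \sum_(i < n) c i *: v i) &
      (forall x, (forall y, eps (mul x y) = 0) -> x = 0)].

(* Main.v *)
(* Each of the circle, the disc, the cylinder and the trinion is a union of two
   closed pieces which are retracts of the plane, so that every bundle has a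
   section over each piece, and these pieces meet in n disjoint connected arcs.
   Comparing the two sections on the arcs describes a bundle by an element of
   G^n; changing the sections acts on G^n by (g, h) . a = g^-1 a h, the orbits
   are the isomorphism classes of bundles and the stabilisers are the
   automorphism groups. Hence Z(M)(Q) = |X| / |G|^2, where X is the set of those
   a in G^n whose bundle restricts to Q. The holonomies along the boundary are
   words in the entries of a, which makes the counts explicit: n = 2 for the
   circle and the cylinder, n = 3 for the trinion, n = 1 for the disc. *)
Require Import Defs.
From HB Require Import structures.
From mathcomp Require Import all_boot all_order all_algebra all_fingroup.
From mathcomp Require Import complex finmap.
From mathcomp Require Import all_classical all_reals all_analysis.
From mathcomp Require Import ring lra.
Import Defs.
Set Implicit Arguments.
Unset Strict Implicit.
Unset Printing Implicit Defensive.
Import Order.TTheory GRing.Theory Num.Theory.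
Import numFieldNormedType.Exports.

Local Open Scope classical_set_scope.
Local Open Scope ring_scope.

(** * Lifts to principal bundles *)

(** Everything rests on one rigidity fact: since G is discrete, two lifts of the same map over a
    connected set differ by a constant element of G. This makes the comparison over an arc a single
    element, and a change of section over a piece a single element too. The pieces are taken closed
    so that maps and sections that agree on overlaps paste to continuous ones. The price is that a
    bundle with prescribed comparison elements cannot be obtained by gluing over open overlaps; it
    is built as a local system, whose topology records the jump across each arc. The formula for Z
    is then a count of elements rather than of orbits: a class P with orbit O contributes 1/|Aut(P)|
    = |O| / |G|^2, and the orbits of the classes restricting to Q partition X. That X is described
    by words is due to the boundary being a union of circles, where isomorphism amounts to equality
    of the holonomy classes, circle by circle. *)

Section Bundles.
Variable gT : finGroupType.

Section Fibres.
Variables (B : topologicalType) (P : pbundle gT B).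
Implicit Types p q : P.

Lemma pact_fibre p q : proj p = proj q -> exists g, q = pact p g.
Proof.
move=> pq; have [U [phi [psi [_ Up [_ phi1 phiM phiK _]]]]] :=
  locally_trivial P (proj p).
exists ((phi p).2^-1 * (phi q).2)%g.
rewrite -[LHS]phiK -?pq// -[RHS]phiK ?proj_pact//; congr psi.
apply: injective_projections; first by rewrite !phi1 ?proj_pact -?pq.
by rewrite phiM// mulKVg.
Qed.

Lemma pact_inj p : injective (pact p).
Proof.
move=> g h; have [U [phi [psi [_ Up [_ _ phiM _ _]]]]] :=
  locally_trivial P (proj p).
by move=> /(congr1 (fun q => (phi q).2)); rewrite !phiM// => /mulgI.
Qed.

Lemma pact_eq_id p g : p = pact p g -> g = 1%g.
Proof. by rewrite -{1}[p]pact1 => /pact_inj. Qed.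

(** In a local trivialisation the G-component is locally constant, because G is discrete. Hence two
    converging families over the same base points keep the offset of their limits. *)
Lemma near_pact_eq (T : Type) (F : set_system T) {FF : Filter F}
    (p q : T -> P) (p0 : P) (g : gT) :
  p @ F --> p0 -> q @ F --> pact p0 g ->
  (\forall t \near F, proj (p t) = proj (q t)) ->
  \forall t \near F, q t = pact (p t) g.
Proof.
move=> pF qF pq; have [U [phi [psi [oU Up [[cphi _] phi1 phiM phiK _]]]]] :=
  locally_trivial P (proj p0).
have nbhs_phi r : U (proj r) -> nbhs r [set r' | U (proj r') /\
    (phi r').2 = (phi r).2].
  move=> Ur; apply: filterI; first exact: proj_continuous (open_nbhs_nbhs _).
  have c2 : {for r, continuous (fun r' => (phi r').2)}.
    by apply: (@continuous_comp _ _ _ phi snd); [exact: cphi|exact: cvg_snd].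
  by apply: (c2 [set (phi r).2]); exact: discrete_set1.
have Upg : U (proj (pact p0 g)) by rewrite proj_pact.
have pN : F (p @^-1` _) := pF _ (nbhs_phi _ Up).
have qN : F (q @^-1` _) := qF _ (nbhs_phi _ Upg).
apply: filterS (filterI (filterI pN qN) pq) => t [[[Upt ptE] [Uqt qtE]] pqt].
rewrite -[LHS]phiK// -[RHS]phiK ?proj_pact//; congr psi.
apply: injective_projections; first by rewrite !phi1 ?proj_pact.
by rewrite qtE !phiM// ptE.
Qed.

End Fibres.

(** The two neighbourhood hypotheses make Q and its complement relatively open in A, so the part of
    A where Q holds is nonempty and clopen in A. *)
Lemma connected_near (T : topologicalType) (A Q : set T) (x0 : T) :
  connected A -> A x0 -> Q x0 ->
  (forall x, A x -> Q x -> \forall y \near x, A y -> Q y) ->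
  (forall x, A x -> ~ Q x -> \forall y \near x, A y -> ~ Q y) ->
  A `<=` Q.
Proof.
move=> cA Ax0 Qx0 op cl.
suff <- : A `&` Q = A by move=> x [].
have oI (D : set T) : open (interior D) by exact: open_interior.
apply: cA; first by exists x0.
- exists (interior [set y | A y -> Q y]) => //.
  rewrite eqEsubset; split=> x [Ax]; last by move=> /interior_subset ?; split; auto.
  by move=> Qx; split => //; exact: op.
- exists (~` interior [set y | A y -> ~ Q y]); first exact: open_closedC.
  rewrite eqEsubset; split=> x [Ax].
    by move=> Qx; split => // /interior_subset /(_ Ax).
  by move=> nx; split => //; apply: contrapT => nQ; exact: nx (cl _ _ _).
Qed.

(* For f = id, this is a section of P over A. *)
Definition is_lift (B : topologicalType) (P : pbundle gT B)
    (T : topologicalType) (f : T -> B) (A : set T) (s : T -> P) : Prop :=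
  {within A, continuous s} /\ forall x, A x -> proj (s x) = f x.

Section Lifts.
Variables (B : topologicalType) (P : pbundle gT B) (T : topologicalType).
Implicit Types (f : T -> B) (A : set T) (s : T -> P).

Lemma is_liftS f A A' s : A' `<=` A -> is_lift f A s -> is_lift f A' s.
Proof.
move=> sA [cs ps]; split; first exact: continuous_subspaceW cs.
by move=> x /sA; exact: ps.
Qed.

Lemma is_lift_pact f A s g : is_lift f A s -> is_lift f A (fun x => pact (s x) g).
Proof.
move=> [/subspace_continuousP cs ps]; split; last first.
  by move=> x Ax; rewrite proj_pact ps.
apply/subspace_continuousP => x Ax.
apply: (@cvg_comp _ _ _ s (fun p => pact p g) _ _ _ (cs x Ax)).
exact: pact_continuous.
Qed.

Lemma near_lift_eq f A s s' x g : is_lift f A s -> is_lift f A s' -> A x ->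
  s' x = pact (s x) g -> \forall y \near x, A y -> s' y = pact (s y) g.
Proof.
move=> [/subspace_continuousP cs ps] [/subspace_continuousP cs' ps'] Ax e.
apply: (near_pact_eq (F := within A (nbhs x)) (p0 := s x)).
- exact: cs.
- by rewrite -e; exact: cs'.
- by apply: filterS (withinT _ _) => y Ay; rewrite ps// ps'.
Qed.

(** The offset between two lifts is locally constant by [near_lift_eq], hence constant on a
    connected set. *)
Lemma connected_lift_eq f A s s' : connected A -> is_lift f A s ->
  is_lift f A s' -> exists g, forall x, A x -> s' x = pact (s x) g.
Proof.
move=> cA ls ls'.
have [[x0 Ax0]|] := pselect (A !=set0); last first.
  by move=> A0; exists 1%g => x Ax; case: A0; exists x.
have fib x : A x -> exists g, s' x = pact (s x) g.
  by move=> Ax; apply: pact_fibre; rewrite ls.2// ls'.2.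
have [g sg] := fib x0 Ax0; exists g.
apply: (connected_near cA Ax0 sg).
  by move=> x Ax /(near_lift_eq ls ls' Ax).
(* Where the offset is not g it is some other h, which persists nearby; the action being free, g
   stays excluded there. *)
move=> x Ax nQ; have [h sh] := fib x Ax.
have := near_lift_eq ls ls' Ax sh; apply: filterS => y Qy /[dup] Ay /Qy ->.
by move=> /pact_inj hg; apply: nQ; rewrite -hg.
Qed.

(** Connectedness of the overlap makes the offset a single g; after translating s by g the lifts
    agree there and paste along the closed sets. *)
Lemma is_liftU f A A' s s' : closed A -> closed A' -> connected (A `&` A') ->
  is_lift f A s -> is_lift f A' s' -> exists s'', is_lift f (A `|` A') s''.
Proof.
move=> clA clA' cAA' ls ls'.
have [g sg] : exists g, forall x, (A `&` A') x -> s' x = pact (s x) g.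
  apply: (connected_lift_eq cAA'); first exact: is_liftS ls.
  exact: is_liftS ls'.
have lsg := is_lift_pact g ls.
pose t x := if `[< A x >] then pact (s x) g else s' x.
have tA : {in A, (fun x => pact (s x) g) =1 t}.
  by move=> x /set_mem Ax; rewrite /t asboolT.
have tA' : {in A', s' =1 t}.
  by move=> x /set_mem Ax; rewrite /t; case: asboolP => // ?; exact: sg.
exists t; split.
  apply: withinU_continuous => //; first exact: subspace_eq_continuous tA lsg.1.
  exact: subspace_eq_continuous tA' ls'.1.
move=> x [Ax|Ax]; first by rewrite -tA ?inE//; exact: lsg.2.
by rewrite -tA' ?inE//; exact: ls'.2.
Qed.


Lemma locally_liftable f (x : T) : continuous f ->
  exists (W : set T) s, nbhs x W /\ is_lift f W s.
Proof.
move=> cf; have [U [phi [psi [oU Uf [[_ cpsi] _ _ _ psiK]]]]] :=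
  locally_trivial P (f x).
exists (f @^-1` U), (fun y => psi (f y, 1%g)); split.
  by apply: cf; exact: open_nbhs_nbhs.
split; last by move=> y Uy; have [] := psiK (f y, 1%g : discrete_topology gT) Uy.
apply/subspace_continuousP => y Uy; apply: cvg_within_filter.
apply: (@continuous_comp _ _ _
  (fun y => (f y, 1%g : discrete_topology gT)) psi); last exact: cpsi.
by apply: continuous_pair; [exact: cf|exact: cst_continuous].
Qed.

Lemma is_lift_push (Q : pbundle gT B) (F : P -> Q) f A s :
  bundle_iso F -> is_lift f A s -> is_lift f A (F \o s).
Proof.
move=> [cF pF _ _] [/subspace_continuousP cs ps].
split; last by move=> x Ax; rewrite -[RHS](ps x Ax); exact: pF.
apply/subspace_continuousP => x Ax.
by apply: (@cvg_comp _ _ _ s F _ _ _ (cs x Ax)); exact: cF.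
Qed.

End Lifts.
End Bundles.

(** * Lifts over rectangles of the plane *)

Section RectangleLifts.
Variable R : realType.

(* Apply the local hypothesis at the supremum of the x with Q a x. *)
Lemma interval_glue (Q : R -> R -> Prop) :
  (forall a b a' b', a <= a' -> b' <= b -> Q a b -> Q a' b') ->
  (forall a b c, a <= b -> b <= c -> Q a b -> Q b c -> Q a c) ->
  (forall t, exists2 e, 0 < e & Q (t - e) (t + e)) ->
  forall a b, a <= b -> Q a b.
Proof.
move=> Qmono Qglue Qloc a b ab.
pose S := [set x | a <= x <= b /\ Q a x].
have Sa : S a.
  split; first by rewrite lexx.
  by have [e e0] := Qloc a; apply: Qmono; rewrite ?lerDl ?gerBl ltW.
have supS : has_sup S.
  by split; [exists a|exists b => x [/andP[]]].
have [e e0 Qe] := Qloc (sup S).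
have [x [/andP[ax xb] Qax] xs] := sup_adherent e0 supS.
have xS : x <= sup S by apply: ub_le_sup; [exact: supS.2|split; rewrite ?ax].
pose y := Num.min b (sup S + e).
have xy : x <= y by rewrite le_min xb (le_trans xS)// lerDl ltW.
have yb : y <= b by rewrite ge_min lexx.
have Qay : Q a y.
  apply: (Qglue _ x) => //; apply: Qmono Qe; first exact: ltW.
  by rewrite ge_min lexx orbT.
have : y <= sup S.
  by apply: ub_le_sup; [exact: supS.2|split; rewrite ?yb ?(le_trans ax)].
rewrite ge_min -[X in _ || (_ <= X)]addr0 lerD2l [e <= 0]leNgt e0 orbF => bs.
suff <- : y = b by [].
by apply/min_idPl; rewrite (le_trans bs)// lerDl ltW.
Qed.

Definition rect (a b c d : R) : set (R * R) :=
  [set z | (a <= z.1 <= b) && (c <= z.2 <= d)].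

Lemma closed_rect a b c d : closed (rect a b c d).
Proof.
have -> : rect a b c d = (fst @^-1` `[a, b]) `&` (snd @^-1` `[c, d]).
  rewrite eqEsubset; split=> z; first by move=> /andP[? ?]; split; rewrite /= in_itv.
  by move=> [/= + +]; rewrite !in_itv/= /rect/= => -> ->.
apply: closedI; apply: closed_comp; try exact: interval_closed.
  by move=> z _; exact: cvg_fst.
by move=> z _; exact: cvg_snd.
Qed.

Lemma connected_vertical a c d : connected (rect a a c d).
Proof.
have -> : rect a a c d = pair a @` `[c, d].
  rewrite eqEsubset; split=> [[x y]|_ [y + <-]]; rewrite /rect/= ?in_itv/=.
    by move=> /andP[/le_anti <- cd]; exists y => //=; rewrite in_itv.
  by rewrite lexx.
apply: connected_continuous_connected; first exact: segment_connected.
apply: continuous_subspaceT => y; apply: continuous_pair; last exact: cvg_id.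
exact: cst_continuous.
Qed.

Lemma connected_horizontal a b c : connected (rect a b c c).
Proof.
have -> : rect a b c c = pair^~ c @` `[a, b].
  rewrite eqEsubset; split=> [[x y]|_ [x + <-]]; rewrite /rect/= ?in_itv/=.
    by move=> /andP[ab /le_anti <-]; exists x => //=; rewrite in_itv.
  by move=> ->; rewrite lexx.
apply: connected_continuous_connected; first exact: segment_connected.
apply: continuous_subspaceT => y; apply: continuous_pair; first exact: cvg_id.
exact: cst_continuous.
Qed.

Lemma connected_plane : connected [set: R * R].
Proof.
have -> : [set: R * R] = \bigcup_(z in [set: R * R])
    ((fun t => (t * z.1, t * z.2)) @` `[(0 : R), 1]).
  rewrite eqEsubset; split=> // z _; exists z => //; exists 1.
    by rewrite /= in_itv/= lexx ler01.
  by rewrite !mul1r -surjective_pairing.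
apply: bigcup_connected.
  exists (0, 0) => z _; exists 0; first by rewrite /= in_itv/= lexx ler01.
  by rewrite !mul0r.
move=> z _; apply: connected_continuous_connected; first exact: segment_connected.
apply: continuous_subspaceT => t.
by apply: (@continuous_pair R R R ( *%R^~ z.1) ( *%R^~ z.2)); exact: mulrr_continuous.
Qed.

Variables (gT : finGroupType) (B : topologicalType) (P : pbundle gT B).
Variable f : R * R -> B.
Hypothesis cf : continuous f.

(* Subdivision: a lift exists near each point of the strip, and lifts over two
   rectangles with a common edge can be glued as the edge is connected. *)
Lemma rect_lift a b c d : a <= b -> c <= d ->
  exists s : R * R -> P, is_lift f (rect a b c d) s.
Proof.
move=> ab cd; move: a b ab; apply: interval_glue.
- move=> a b a' b' aa' bb' [s ls]; exists s; apply: is_liftS ls => z.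
  rewrite /rect/= => /andP[/andP[? ?] ->]; rewrite andbT.
  by rewrite (le_trans aa')//= (le_trans _ bb').
- move=> a b c' ab bc [s ls] [s' ls'].
  have -> : rect a c' c d = rect a b c d `|` rect b c' c d.
    rewrite eqEsubset; split=> [z|z []]; rewrite /rect/= => /andP[/andP[? ?] ->].
    + case: (leP z.1 b) => zb; [left|right]; apply/andP; split => //; apply/andP; split => //.
      exact: ltW.
    + by rewrite andbT; apply/andP; split => //; exact: le_trans bc.
    + by rewrite andbT; apply/andP; split => //; exact: le_trans ab _.
  apply: is_liftU ls ls'; try exact: closed_rect.
  suff -> : rect a b c d `&` rect b c' c d = rect b b c d.
    exact: connected_vertical.
  rewrite eqEsubset; split=> z; rewrite /rect/=.
    by move=> [/andP[/andP[_ ->] ->] /andP[/andP[-> _] _]].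
  by move=> /andP[/andP[bz zb] ->]; rewrite bz zb (le_trans ab)// (le_trans zb).
move=> x.
(* The width e is quantified inside the predicate so that [interval_glue] also applies in the
   vertical direction: gluing two boxes keeps the smaller width. *)
suff [e [e0 [s ls]]] : exists e, 0 < e /\
    exists s : R * R -> P, is_lift f (rect (x - e) (x + e) c d) s.
  by exists e => //; exists s.
move: c d cd; apply: interval_glue.
- move=> c d c' d' cc' dd' [e [e0 [s ls]]]; exists e; split => //; exists s.
  apply: is_liftS ls => z; rewrite /rect/= => /andP[-> /andP[? ?]]/=.
  by rewrite (le_trans cc')//= (le_trans _ dd').
- move=> c d d' cd dd' [e [e0 [s ls]]] [e' [e'0 [s' ls']]].
  pose m := Num.min e e'.
  have [me me'] : m <= e /\ m <= e' by rewrite !ge_min !lexx orbT.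
  exists m; split; first by rewrite lt_min e0.
  have sub e1 u v : m <= e1 -> rect (x - m) (x + m) u v `<=` rect (x - e1) (x + e1) u v.
    move=> me1 z; rewrite /rect/= => /andP[/andP[? ?] ->]; rewrite andbT.
    by apply/andP; split; lra.
  have {}ls := is_liftS (sub _ c d me) ls.
  have {}ls' := is_liftS (sub _ d d' me') ls'.
  have -> : rect (x - m) (x + m) c d' =
      rect (x - m) (x + m) c d `|` rect (x - m) (x + m) d d'.
    rewrite eqEsubset; split=> [z|z []]; rewrite /rect/= => /andP[-> /andP[? ?]]/=.
    + case: (leP z.2 d) => zb; [left|right]; apply/andP; split => //.
      exact: ltW.
    + by apply/andP; split => //; exact: le_trans dd'.
    + by apply/andP; split => //; exact: le_trans cd _.
  apply: is_liftU ls ls'; try exact: closed_rect.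
  suff -> : rect (x - m) (x + m) c d `&` rect (x - m) (x + m) d d' =
      rect (x - m) (x + m) d d by exact: connected_horizontal.
  rewrite eqEsubset; split=> z; rewrite /rect/=.
    by move=> [/andP[-> /andP[_ ->]] /andP[_ /andP[-> _]]].
  by move=> /andP[-> /andP[dz zd]]; rewrite dz zd (le_trans cd)// (le_trans zd).
move=> y; have [W [s [/nbhs_ballP[e e0 eW] ls]]] := locally_liftable P (x, y) cf.
have e20 : 0 < e / 2 by rewrite divr_gt0.
exists (e / 2) => //; exists (e / 2); split => //; exists s.
apply: is_liftS ls => z; rewrite /rect/= => /andP[/andP[? ?] /andP[? ?]].
apply: eW; split; rewrite /ball/=; rewrite ltr_norml; apply/andP; split; simpl in *; lra.
Qed.

(** Since f inverts u on H, a lift of f over the rectangle composed with u is a section over H. *)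
Lemma chart_section (u : B -> R * R) (H : set B) a b c d :
  a <= b -> c <= d -> continuous u ->
  (forall x, H x -> rect a b c d (u x) /\ f (u x) = x) ->
  exists s : B -> P, is_lift id H s.
Proof.
move=> ab cd cu uH; have [s [/subspace_continuousP cs ps]] := rect_lift ab cd.
exists (s \o u); split; last by move=> x /uH[ru fu] /=; rewrite ps.
apply/subspace_continuousP => x Hx; have [ru fu] := uH x Hx.
apply: (@cvg_comp _ _ _ u s _ _ _ _ (cs _ ru)) => N; rewrite /within/= => nN.
have uN : nbhs x (u @^-1` _) := cu x _ nN.
by apply: filterS uN => y /= yN Hy; apply: yN; have [] := uH y Hy.
Qed.

End RectangleLifts.

(** * Construction of bundles and of isomorphisms *)

Section ClosedCovers.
Variables (gT : finGroupType) (B : topologicalType) (J : finType).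
Variable H : J -> set B.
Hypothesis closedH : forall j, closed (H j).
Hypothesis coverH : forall x, exists j, H j x.

(** The map must send [pact (s j x) g] to [pact (t j x) g]; the last hypothesis says exactly that
    this does not depend on j. *)
Lemma closed_cover_map (P Q : pbundle gT B) (s : J -> B -> P) (t : J -> B -> Q) :
  (forall j, is_lift id (H j) (s j)) -> (forall j, is_lift id (H j) (t j)) ->
  (forall j k x g, H j x -> H k x ->
     s k x = pact (s j x) g -> t k x = pact (t j x) g) ->
  exists f : P -> Q, [/\ continuous f, forall p, proj (f p) = proj p,
    forall p g, f (pact p g) = pact (f p) g &
    forall j x, H j x -> f (s j x) = t j x].
Proof.
move=> ls lt compat.
have fib j p : H j (proj p) -> exists g, p = pact (s j (proj p)) g.
  by move=> Hj; apply: pact_fibre; rewrite (ls j).2.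
have ex p : exists q, exists j g, [/\ H j (proj p),
    p = pact (s j (proj p)) g & q = pact (t j (proj p)) g].
  have [j Hj] := coverH (proj p); have [g pg] := fib j p Hj.
  by exists (pact (t j (proj p)) g), j, g.
have [f fP] := choice ex.
have fE j g p : H j (proj p) -> p = pact (s j (proj p)) g ->
    f p = pact (t j (proj p)) g.
  move=> Hj pj; have [k [h [Hk pk ->]]] := fP p.
  have : s j (proj p) = pact (s k (proj p)) (h * g^-1)%g.
    by rewrite pactM -pk [in RHS]pj -pactM mulgV pact1.
  by move=> /(compat _ _ _ _ Hk Hj) ->; rewrite -pactM mulgKV.
have fproj p : proj (f p) = proj p.
  by have [j [g [Hj _ ->]]] := fP p; rewrite proj_pact (lt j).2.
pose pr : P -> B := @proj gT B P.
exists f; split => //.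
- move=> p0 N nN.
  (* Continuity is checked on one closed piece at a time. A piece missing the base point of p0 is
     missed nearby; on the others p is the translate of [s j] by a fixed g near p0. Finiteness of J
     then combines the neighbourhoods. *)
  have near_j j : \forall p \near p0, H j (proj p) -> N (f p).
    have [Hj|nHj] := pselect (H j (proj p0)); last first.
      have nC : nbhs (proj p0) (~` H j).
        by apply: open_nbhs_nbhs; split => //; exact: closed_openC.
      have pC : nbhs p0 (pr @^-1` _) := @proj_continuous _ _ P _ _ nC.
      by apply: filterS pC => p nH /nH.
    have [g pg] := fib j p0 Hj.
    pose F := within (pr @^-1` H j) (nbhs p0).
    have FH : F (pr @^-1` H j) by exact: withinT.
    have projF : pr @ F --> within (H j) (nbhs (proj p0)).
      move=> V nV; have pV : nbhs p0 (pr @^-1` _) := @proj_continuous _ _ P _ _ nV.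
      by apply: filterS pV => p; apply.
    have sF : (s j \o pr) @ F --> s j (proj p0).
      apply: (@cvg_comp _ _ _ pr (s j) _ _ _ projF).
      by have [/subspace_continuousP cs _] := ls j; exact: cs.
    have tF : (fun p => pact (t j (proj p)) g) @ F --> f p0.
      rewrite (fE j g)//.
      apply: (@cvg_comp _ _ _ pr (fun x => pact (t j x) g) _ _ _ projF).
      by have [/subspace_continuousP ct _] := is_lift_pact g (lt j); exact: ct.
    have near_s : \forall p \near F, p = pact (s j (proj p)) g.
      apply: (near_pact_eq (p := s j \o pr) (q := id) sF).
        by rewrite /= -pg; apply: cvg_within.
      by apply: filterS FH => p Hp /=; rewrite (ls j).2.
    suff : F (f @^-1` N) by [].
    apply: filterS (filterI (filterI FH near_s) (tF _ nN)) => p [[Hp ps] /=].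
    by rewrite (fE j g).
  have : \forall p \near p0, forall j, H j (proj p) -> N (f p).
    exact: filter_forall.
  by apply: filterS => p HN; have [j Hj] := coverH (proj p); exact: HN Hj.
- move=> p g; have [j [h [Hj pj fp]]] := fP p.
  rewrite fp -pactM -[in RHS](proj_pact p g); apply: fE; rewrite proj_pact//.
  by rewrite pactM -pj.
- move=> j x Hj; rewrite (fE j 1%g) ?pact1 ?(ls j).2//.
Qed.

(** By freeness of the action the compatibility condition is symmetric in s and t, so the same
    construction also gives the inverse. *)
Lemma closed_cover_iso (P Q : pbundle gT B) (s : J -> B -> P) (t : J -> B -> Q) :
  (forall j, is_lift id (H j) (s j)) -> (forall j, is_lift id (H j) (t j)) ->
  (forall j k x g, H j x -> H k x ->
     s k x = pact (s j x) g -> t k x = pact (t j x) g) ->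
  exists f : P -> Q, bundle_iso f /\ forall j x, H j x -> f (s j x) = t j x.
Proof.
move=> ls lt compat.
have compat' j k x g : H j x -> H k x ->
    t k x = pact (t j x) g -> s k x = pact (s j x) g.
  move=> Hj Hk tg; have [h sh] : exists h, s k x = pact (s j x) h.
    by apply: pact_fibre; rewrite (ls j).2// (ls k).2.
  suff -> : g = h by [].
  by apply: (@pact_inj _ _ _ (t j x)); rewrite -tg; exact: compat.
have [f [cf pf fM fs]] := closed_cover_map ls lt compat.
have [f' [cf' pf' fM' ft]] := closed_cover_map lt ls compat'.
exists f; split => //; split => //; exists f'; split => // p.
- have [j Hj] := coverH (proj p).
  have [g ->] : exists g, p = pact (s j (proj p)) g.
    by apply: pact_fibre; rewrite (ls j).2.
  by rewrite fM fM' fs// ft.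
- have [j Hj] := coverH (proj p).
  have [g ->] : exists g, p = pact (t j (proj p)) g.
    by apply: pact_fibre; rewrite (lt j).2.
  by rewrite fM' fM ft// fs.
Qed.

End ClosedCovers.

(* [c b x] is the parallel transport from the fibre at b to the fibre at a
   nearby point x; the total space is B * G with the topology whose germs of
   sections at (b, g) are x |-> (x, c b x * g). *)
Section LocalSystems.
Variables (gT : finGroupType) (B : topologicalType) (c : B -> B -> gT).
Hypothesis c1 : forall b, c b b = 1%g.
Hypothesis cM : forall b, \forall x \near b, \forall y \near x,
  c b y = (c x y * c b x)%g.

Definition lsys_total : Type := (B * gT)%type.

HB.instance Definition _ := Choice.on lsys_total.

Definition lsys_nbhs (p : lsys_total) : set_system lsys_total :=
  (fun x => (x, c p.1 x * p.2)%g : lsys_total) @ nbhs p.1.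

HB.instance Definition _ := hasNbhs.Build lsys_total lsys_nbhs.

Let lsys_nbhs_filter (p : lsys_total) : ProperFilter (nbhs p).
Proof. exact: fmap_proper_filter. Qed.

Let lsys_nbhs_singleton (p : lsys_total) A : nbhs p A -> A p.
Proof.
case: p => b g /nbhs_singleton /=.
by rewrite /= c1 mul1g.
Qed.

(** This is where the cocycle condition [cM] enters: going from b to y directly or through a nearby
    x reaches the same point of the fibre. *)
Let lsys_nbhs_nbhs (p : lsys_total) A : nbhs p A -> nbhs p (nbhs^~ A).
Proof.
case: p => b g Abg; have /nbhs_interior nA : nbhs b _ := Abg.
change (nbhs b [set x | nbhs x [set y | A (y, c x y * (c b x * g))%g]]).
apply: filterS (filterI nA (cM b)) => x [Ax cx].
apply: filterS (filterI Ax cx) => y [/= Ay cy].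
by rewrite mulgA -cy.
Qed.

HB.instance Definition _ := Nbhs_isNbhsTopological.Build lsys_total
  lsys_nbhs_filter lsys_nbhs_singleton lsys_nbhs_nbhs.

Definition lsys_proj (p : lsys_total) : B := p.1.

Definition lsys_act (p : lsys_total) (g : gT) : lsys_total := (p.1, p.2 * g)%g.

Lemma lsys_act1 p : lsys_act p 1%g = p.
Proof. by rewrite /lsys_act mulg1; case: p. Qed.

Lemma lsys_actM p g h : lsys_act p (g * h)%g = lsys_act (lsys_act p g) h.
Proof. by rewrite /lsys_act mulgA. Qed.

Lemma lsys_proj_continuous : continuous lsys_proj.
Proof. by move=> p N nN; exact: nN. Qed.

Lemma lsys_act_continuous g : continuous (fun p => lsys_act p g).
Proof.
move=> p N nN; have nN' : nbhs p.1 _ := nN.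
change (nbhs p.1 [set x | N (lsys_act (x, c p.1 x * p.2)%g g)]).
by apply: filterS nN' => x /=; rewrite /lsys_act/= mulgA.
Qed.

Lemma lsys_locally_trivial b : exists U phi psi,
  [/\ open U, U b & trivialises lsys_proj lsys_act U phi psi].
Proof.
(* The fibres are framed by transport from b; this frame is continuous at exactly those x near which
   transport from b factors through x. *)
pose V := [set x | \forall y \near x, c b y = (c x y * c b x)%g].
exists (interior V), (fun p => (p.1, ((c b p.1)^-1 * p.2)%g : discrete_topology gT)),
  (fun x => (x.1, c b x.1 * x.2)%g : lsys_total).
split; [exact: open_interior|exact: cM|].
have VV x : interior V x -> V x by exact: interior_subset.
split.
- split=> [p /VV Vp|x /VV Vx].
    apply: continuous_pair; first exact: lsys_proj_continuous.
    move=> N nN.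
    change (nbhs p.1 [set x | N ((c b x)^-1 * (c p.1 x * p.2))%g]).
    apply: filterS Vp => x /= ->; rewrite invMg -!mulgA mulKg.
    exact: nbhs_singleton nN.
  move=> N nN; have nN' : nbhs x.1 _ := nN.
  have n2 : nbhs x.2 [set x.2] by exact: discrete_set1.
  exists ([set y | N (y, c x.1 y * (c b x.1 * x.2))%g /\
      c b y = (c x.1 y * c b x.1)%g], [set x.2]).
    by split => //; exact: filterI nN' Vx.
  by move=> [y g] [/= [Ny cy] ->]; rewrite /preimage/= cy -mulgA.
- by [].
- by move=> p g _; rewrite /= mulgA.
- by move=> [x g] _; rewrite /= mulKVg.
- by move=> [x g] _; rewrite /= mulKg.
Qed.

Definition local_system : pbundle gT B :=
  @PBundle gT B lsys_total lsys_proj lsys_act lsys_act1 lsys_actM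
    lsys_proj_continuous lsys_act_continuous (fun _ _ => erefl)
    lsys_locally_trivial.

Lemma local_system_section (A : set B) (r : B -> gT) :
  (forall x, A x -> \forall y \near x, A y -> r y = (c x y * r x)%g) ->
  is_lift (P := local_system) id A (fun x => (x, r x)).
Proof.
move=> rA; split => //; apply/subspace_continuousP => x Ax N nN.
have nN' : nbhs x _ := nN.
change (nbhs x [set y | A y -> N (y, r y)]).
apply: filterS (filterI nN' (rA x Ax)) => y [/= Ny ry] Ay.
by rewrite ry.
Qed.

End LocalSystems.

(** * Bundles on a space cut into two pieces *)

(** Closedness serves pasting, connectedness makes every comparison of sections a single group
    element, and nonemptiness makes that element unique. The two pieces may coincide, as they do for
    the disc. *)
Record bisection (M : topologicalType) (n : nat) := Bisection {
  upper : set M;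
  lower : set M;
  arc : 'I_n -> set M;
  closed_upper : closed upper;
  closed_lower : closed lower;
  upperUlower : upper `|` lower = setT;
  connected_upper : connected upper;
  connected_lower : connected lower;
  upper_nonempty : upper !=set0;
  lower_nonempty : lower !=set0;
  closed_arc : forall i, closed (arc i);
  connected_arc : forall i, connected (arc i);
  arc_nonempty : forall i, arc i !=set0;
  arc_inj : forall i j x, arc i x -> arc j x -> i = j;
  upperIlower : upper `&` lower = \bigcup_i arc i;
  upper_section : forall gT (P : pbundle gT M), exists s : M -> P, is_lift id upper s;
  lower_section : forall gT (P : pbundle gT M), exists s : M -> P, is_lift id lower s
}.

Section Frames.
Variables (gT : finGroupType) (M : topologicalType) (n : nat).
Variable D : bisection M n.
Local Notation data := {ffun 'I_n -> gT}.

Lemma arc_upper i x : arc D i x -> upper D x.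
Proof. by move=> ax; have [] : (upper D `&` lower D) x by rewrite upperIlower; exists i. Qed.

Lemma arc_lower i x : arc D i x -> lower D x.
Proof. by move=> ax; have [] : (upper D `&` lower D) x by rewrite upperIlower; exists i. Qed.

Definition is_frame (P : pbundle gT M) (s t : M -> P) (a : data) : Prop :=
  [/\ is_lift id (upper D) s, is_lift id (lower D) t &
      forall i x, arc D i x -> t x = pact (s x) (a i)].

Definition has_data (P : pbundle gT M) (a : data) : Prop :=
  exists s t, is_frame (P := P) s t a.

Lemma has_data_exists P : exists a, has_data P a.
Proof.
have [s ls] := upper_section D P; have [t lt] := lower_section D P.
have ex i : exists g, forall x, arc D i x -> t x = pact (s x) g.
  apply: (connected_lift_eq (@connected_arc _ _ D i)).
    by apply: is_liftS ls => x; exact: arc_upper.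
  by apply: is_liftS lt => x; exact: arc_lower.
have [a ha] := choice ex; exists (finfun a), s, t; split => // i x ax.
by rewrite ffunE; exact: ha.
Qed.

Definition twist (a : data) (u : gT * gT) : data :=
  [ffun i => u.1^-1 * a i * u.2]%g.

Lemma frame_twist (P : pbundle gT M) (s t : M -> P) a u : is_frame s t a ->
  is_frame (fun x => pact (s x) u.1) (fun x => pact (t x) u.2) (twist a u).
Proof.
move=> [ls lt st]; split; [exact: is_lift_pact|exact: is_lift_pact|].
move=> i x ax; rewrite ffunE (st i)// -!pactM; congr pact.
by rewrite mulgA mulKVg.
Qed.

Lemma frame_change (P : pbundle gT M) (s t s' t' : M -> P) a a' :
  is_frame s t a -> is_frame s' t' a' -> exists u, [/\ a' = twist a u,
    forall x, upper D x -> s' x = pact (s x) u.1 &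
    forall x, lower D x -> t' x = pact (t x) u.2].
Proof.
move=> [ls lt st] [ls' lt' st'].
have [g sg] := connected_lift_eq (@connected_upper _ _ D) ls ls'.
have [h th] := connected_lift_eq (@connected_lower _ _ D) lt lt'.
exists (g, h); split => //; apply/ffunP => i; rewrite ffunE/=.
have [x ax] := @arc_nonempty _ _ D i.
have := st' i x ax; rewrite th ?sg; [|exact: arc_upper ax|exact: arc_lower ax].
move=> /esym; rewrite (st i)// -!pactM => /pact_inj E.
by rewrite -mulgA -E mulKg.
Qed.

Lemma has_data_twist P a a' : has_data P a ->
  has_data P a' <-> exists u, a' = twist a u.
Proof.
move=> [s [t st]]; split=> [[s' [t' st']]|[u ->]].
  by have [u [-> _ _]] := frame_change st st'; exists u.
by exists (fun x => pact (s x) u.1), (fun x => pact (t x) u.2); exact: frame_twist.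
Qed.

(** The pieces overlap only in the arcs, where both frames have the same offset [a i]; this is the
    compatibility asked by [closed_cover_iso]. *)
Lemma frame_iso (P Q : pbundle gT M) (s t : M -> P) (s' t' : M -> Q) a :
  is_frame s t a -> is_frame s' t' a ->
  exists f : P -> Q, [/\ bundle_iso f, forall x, upper D x -> f (s x) = s' x &
    forall x, lower D x -> f (t x) = t' x].
Proof.
move=> [ls lt st] [ls' lt' st'].
pose H b := if b then upper D else lower D.
have [] := @closed_cover_iso gT M bool H _ _ P Q
  (fun b => if b then s else t) (fun b => if b then s' else t').
- by case; [exact: closed_upper|exact: closed_lower].
- move=> x; have : setT x by [].
  by rewrite -(upperUlower D) => -[]; [exists true|exists false].
- by case.
- by case.
- have arcs x : upper D x -> lower D x -> exists i, arc D i x.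
    move=> ux lx; have : (\bigcup_i arc D i) x by rewrite -upperIlower.
    by move=> [i _ ax]; exists i.
  case; case => x g /= ux lx.
  + by move=> /pact_eq_id ->; rewrite pact1.
  + have [i ax] := arcs x ux lx; rewrite (st i)// (st' i)// => /pact_inj <- //.
  + have [i ax] := arcs x lx ux; rewrite (st i)// (st' i)// -!pactM.
    by move=> /pact_eq_id ->; rewrite pact1.
  + by move=> /pact_eq_id ->; rewrite pact1.
- move=> f [fi fH]; exists f; split => // x; [exact: (fH true)|exact: (fH false)].
Qed.

Lemma frame_push (P Q : pbundle gT M) (f : P -> Q) (s t : M -> P) a :
  bundle_iso f -> is_frame s t a -> is_frame (f \o s) (f \o t) a.
Proof.
move=> fi [ls lt st]; split; [exact: is_lift_push ls|exact: is_lift_push lt|].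
by have [_ _ fM _] := fi; move=> i x ax /=; rewrite (st i)// fM.
Qed.

Lemma has_data_iso (P Q : pbundle gT M) a :
  has_data P a -> has_data Q a <-> isomorphic P Q.
Proof.
move=> [s [t st]]; split=> [[s' [t' st']]|[f fi]].
  by have [f [fi _ _]] := frame_iso st st'; exists f.
by exists (f \o s), (f \o t); exact: frame_push.
Qed.

Let index x : option 'I_n := [pick i | `[< arc D i x >]].

Let index_arc i x : arc D i x -> index x = Some i.
Proof.
move=> ax; rewrite /index; case: pickP => [j /asboolP jx|/(_ i)].
  by congr Some; exact: arc_inj jx ax.
by rewrite asboolT.
Qed.

Let index_none x : (forall i, ~ arc D i x) -> index x = None.
Proof. by move=> nx; rewrite /index; case: pickP => // j /asboolP /nx. Qed.

Let arc_cases x :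
  [\/ exists i, arc D i x, ~ upper D x | upper D x /\ ~ lower D x].
Proof.
have [ux|] := pselect (upper D x); last by constructor 2.
have [lx|] := pselect (lower D x); last by constructor 3.
have : (\bigcup_i arc D i) x by rewrite -upperIlower.
by move=> [i _ ax]; constructor 1; exists i.
Qed.

Let near_closedC (A : set M) x : closed A -> ~ A x -> \forall y \near x, ~ A y.
Proof. by move=> cA nx; apply: open_nbhs_nbhs; split => //; exact: closed_openC. Qed.

Let near_arc i x : arc D i x -> \forall y \near x, forall j, arc D j y -> j = i.
Proof.
move=> ax; apply: filter_forall => j; have [->|ji] := eqVneq j i; first exact: nearW.
have : \forall y \near x, ~ arc D j y.
  apply: near_closedC; first exact: closed_arc.
  by move=> jx; move/eqP: ji; apply; exact: arc_inj jx ax.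
by apply: filterS => y ny /ny.
Qed.

(* The fibre over x is framed by s if x lies in the upper part, and by t
   otherwise; transport is trivial inside each part and multiplies by
   (a i)^-1 when leaving the upper part through the i-th arc. *)
Let transport (a : data) x y : gT :=
  if index x is Some i then (if `[< upper D y >] then 1 else (a i)^-1)%g else 1%g.

Let transport_upper a x y : upper D y -> transport a x y = 1%g.
Proof. by move=> uy; rewrite /transport asboolT//; case: index. Qed.

Let transport_noarc a x y : (forall i, ~ arc D i x) -> transport a x y = 1%g.
Proof. by move=> nx; rewrite /transport index_none. Qed.

Let transport_arc a i x y : arc D i x -> ~ upper D y -> transport a x y = (a i)^-1%g.
Proof. by move=> ax ny; rewrite /transport (index_arc ax) asboolF. Qed.

Let transport1 a x : transport a x x = 1%g.
Proof.
have [ux|nx] := pselect (upper D x); first exact: transport_upper.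
by apply: transport_noarc => i /arc_upper.
Qed.

(** Off the arcs a point has a neighbourhood missing one of the closed pieces, hence missing all
    arcs, and every transport from there is trivial. From b on the i-th arc, the factor [(a i)^-1]
    is collected once, either on the way from b to x or from x to y. *)
Let transportM a b : \forall x \near b, \forall y \near x,
  transport a b y = (transport a x y * transport a b x)%g.
Proof.
have noU x : ~ upper D x -> forall i, ~ arc D i x by move=> nx i /arc_upper.
have noL x : ~ lower D x -> forall i, ~ arc D i x by move=> nx i /arc_lower.
have nearU x : ~ upper D x -> \forall y \near x, ~ upper D y.
  by apply: near_closedC; exact: closed_upper.
have nearL x : ~ lower D x -> \forall y \near x, ~ lower D y.
  by apply: near_closedC; exact: closed_lower.
have [[i bi]|nb|[_ nb]] := arc_cases b.
- apply: filterS (near_arc bi) => x xi; have [[j xj]|nx|[ux nx]] := arc_cases x.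
  + have xi' : arc D i x by rewrite -(xi j).
    apply: nearW => y; rewrite (transport_upper a b (arc_upper xj)) mulg1.
    by rewrite /transport (index_arc bi) (index_arc xi').
  + apply: filterS (nearU _ nx) => y ny; rewrite (transport_noarc a y (noU _ nx)).
    by rewrite !(transport_arc a bi)// mul1g.
  + apply: filterS (nearL _ nx) => y ny.
    have uy : upper D y by have [] : (upper D `|` lower D) y by rewrite upperUlower.
    by rewrite !transport_upper// mulg1.
- apply: filterS (nearU _ nb) => x nx; apply: nearW => y.
  by rewrite !transport_noarc ?mulg1//; exact: noU.
- apply: filterS (nearL _ nb) => x nx; apply: nearW => y.
  by rewrite !transport_noarc ?mulg1//; exact: noL.
Qed.

(** The section over the lower piece is [a i] on the i-th arc and 1 elsewhere; its jump on leaving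
    the arc is cancelled by the transport [(a i)^-1], so it is continuous in the local system. *)
Lemma has_data_realised a : exists P : pbundle gT M, has_data P a.
Proof.
pose r x := if index x is Some i then a i else 1%g.
have r_arc i x : arc D i x -> r x = a i by move=> ax; rewrite /r (index_arc ax).
have r_nupper x : ~ upper D x -> r x = 1%g.
  by move=> nx; rewrite /r index_none// => i /arc_upper.
exists (local_system (transport1 a) (transportM a)).
exists (fun x => (x, 1%g)), (fun x => (x, r x)); split.
- apply: local_system_section => x ux; apply: nearW => y uy.
  by rewrite transport_upper// mulg1.
- apply: local_system_section => x lx; have [[i xi]|nx|[_ //]] := arc_cases x.
    apply: filterS (near_arc xi) => y yi ly.
    have [[j yj]|ny|[_ //]] := arc_cases y.
      have yi' : arc D i y by rewrite -(yi j).
      by rewrite (transport_upper _ _ (arc_upper yj)) mul1g !(r_arc i).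
    by rewrite (r_nupper y)// (transport_arc _ xi)// (r_arc i)// mulVg.
  have : \forall y \near x, ~ upper D y.
    by apply: near_closedC => //; exact: closed_upper.
  apply: filterS => y ny _; rewrite !r_nupper// mulg1 transport_noarc//.
  by move=> i /arc_upper.
- by move=> i x ax; rewrite (r_arc i)// /pact/= /lsys_act/= mul1g.
Qed.

Lemma isomorphic_data (P Q : pbundle gT M) a b :
  has_data P a -> has_data Q b -> isomorphic P Q <-> exists u, b = twist a u.
Proof.
move=> Pa Qb; rewrite -(has_data_iso Q Pa); split.
  by move=> Qa; exact/(has_data_twist _ Qa).
move=> [u bu]; apply/(has_data_twist _ Qb); exists (u.1^-1, u.2^-1)%g.
by apply/ffunP => i; rewrite bu !ffunE/= invgK !mulgA mulgV mul1g mulgK.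
Qed.

Lemma twist1 : twist^~ 1%g =1 id.
Proof. by move=> a; apply/ffunP => i; rewrite ffunE/= invg1 mul1g mulg1. Qed.

Lemma twistM a u v : twist a (u * v)%g = twist (twist a u) v.
Proof. by apply/ffunP => i; rewrite !ffunE/= invMg !mulgA. Qed.

Definition twist_action := TotalAction twist1 twistM.

Lemma bundle_map_eq (P : pbundle gT M) (s t : M -> P) a (f f' : P -> P) :
  is_frame s t a ->
  (forall p g, f (pact p g) = pact (f p) g) ->
  (forall p g, f' (pact p g) = pact (f' p) g) ->
  (forall x, upper D x -> f (s x) = f' (s x)) ->
  (forall x, lower D x -> f (t x) = f' (t x)) -> f = f'.
Proof.
move=> [[_ ps] [_ pt] _] fM fM' fs ft; apply/funext => p.
have [up|lp] : (upper D `|` lower D) (proj p) by rewrite upperUlower.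
  have [g ->] : exists g, p = pact (s (proj p)) g by apply: pact_fibre; rewrite ps//.
  by rewrite fM fM' fs.
have [g ->] : exists g, p = pact (t (proj p)) g by apply: pact_fibre; rewrite pt//.
by rewrite fM fM' ft.
Qed.

(** An automorphism carries the frame to another frame with the same data, so the resulting change u
    of sections fixes a. Conversely each such u gives an automorphism by [frame_iso], and u is
    determined by its effect at one point of each piece. *)
Lemma card_Aut_data (P : pbundle gT M) a : has_data P a ->
  card_Aut P = #|'C[a | twist_action]%g|.
Proof.
move=> [s [t st]]; pose m := #|'C[a | twist_action]%g|.
have aut (i : 'I_m) : exists f : P -> P, [/\ bundle_iso f,
    forall x, upper D x -> f (s x) = pact (s x) (enum_val i).1 &
    forall x, lower D x -> f (t x) = pact (t x) (enum_val i).2].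
  have /astab1P /= au := enum_valP i.
  apply: (@frame_iso P P s t (fun x => pact (s x) (enum_val i).1)
    (fun x => pact (t x) (enum_val i).2) a st).
  by rewrite -[X in is_frame _ _ X]au; exact: frame_twist.
have [F FP] := choice aut.
have FM i p g : F i (pact p g) = pact (F i p) g by have [[]] := FP i.
have Finj : {in [set: 'I_m] &, injective F}.
  move=> i j _ _ Fij; apply: enum_val_inj.
  have [_ si ti] := FP i; have [_ sj tj] := FP j.
  have [x ux] := @upper_nonempty _ _ D; have [y ly] := @lower_nonempty _ _ D.
  apply: injective_projections.
    by apply: (@pact_inj _ _ _ (s x)); rewrite -si// -sj// Fij.
  by apply: (@pact_inj _ _ _ (t y)); rewrite -ti// -tj// Fij.
have FA : F @` [set: 'I_m] = Aut_bundle (P := P).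
  rewrite eqEsubset; split=> [_ [i _ <-]|f fi]; first by have [] := FP i.
  have [u [au su tu]] := frame_change st (frame_push fi st).
  have uC : u \in 'C[a | twist_action]%g by apply/astab1P; rewrite /= -au.
  exists (enum_rank_in uC u) => //.
  have [_ sF tF] := FP (enum_rank_in uC u).
  apply: (bundle_map_eq st) => //; first by have [] := fi.
    by move=> x ux; rewrite sF// enum_rankK_in// -su.
  by move=> x ux; rewrite tF// enum_rankK_in// -tu.
(* The automorphism group is in bijection with the stabiliser, so [card_Aut] does not take its
   default value 0. *)
apply: card_fset_set; rewrite -FA.
apply: card_eq_trans (inj_card_eq Finj) _; rewrite card_eq_sym; exact: card_II.
Qed.

(* The data of P form an orbit of G * G, of which Aut P is a stabiliser. *)
Lemma card_data_Aut (P : pbundle gT M) :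
  (#|[set a | `[< has_data P a >]]%SET| * card_Aut P = #|gT| ^ 2)%N.
Proof.
have [a Pa] := has_data_exists P.
rewrite (card_Aut_data Pa).
have -> : [set b | `[< has_data P b >]]%SET = orbit twist_action [set: gT * gT]%SET a.
  apply/setP => b; rewrite inE; apply/asboolP/orbitP.
    by move=> /(has_data_twist _ Pa)[u ->]; exists u; rewrite ?inE.
  by move=> [u _ <-]; apply/(has_data_twist _ Pa); exists u.
have := card_orbit_stab twist_action [set: gT * gT]%G a.
by rewrite finset.setTI cardsT card_prod => ->.
Qed.

End Frames.

(** * The mass formula for Z *)

Section Counting.
Variables (R : realType) (gT : finGroupType) (M : bordered R) (n : nat).
Variable D : bisection M n.
Variables (Q : pbundle gT (boundary M)) (X : {set {ffun 'I_n -> gT}}).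
Hypothesis XP : forall (P : pbundle gT M) a, has_data D P a ->
  isomorphic (restriction P) Q <-> a \in X.

(** After 1/|Aut| is replaced by (number of data)/|G|^2 and the sums are exchanged, each a in X is
    counted for exactly one i, the class of the bundle realising a, and each a outside X for
    none. *)
Lemma representatives_sum k (s : 'I_k -> pbundle gT M) : representatives Q s ->
  \sum_(i < k) ((card_Aut (s i))%:R)^-1 = #|X|%:R / (#|gT| ^ 2)%:R :> R[i].
Proof.
move=> [sQ s_inj s_surj].
have G0 : (0 < #|gT| ^ 2)%N by rewrite expn_gt0; apply/orP; left; apply/card_gt0P; exists 1%g.
have nz m m' : (m * m' = #|gT| ^ 2)%N ->
    (m'%:R)^-1 = m%:R / (#|gT| ^ 2)%:R :> R[i].
  move=> mm'; move: G0; rewrite -mm' muln_gt0 natrM => /andP[m0 m'0].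
  by rewrite invfM mulrA divff ?mul1r// pnatr_eq0 -lt0n.
rewrite (eq_bigr _ (fun i _ => nz _ _ (card_data_Aut D (s i)))).
rewrite -mulr_suml -natr_sum; congr (_%:R / _).
transitivity (\sum_(i < k) \sum_(a : {ffun 'I_n -> gT}) `[< has_data D (s i) a >])%N.
  apply: eq_bigr => i _; rewrite -sum1_card big_mkcond/=; apply: eq_bigr => a _.
  by rewrite inE; case: asboolP.
rewrite exchange_big/= -sum1_card [RHS]big_mkcond/=; apply: eq_bigr => a _.
case: ifPn => [aX|aX]; last first.
  rewrite big1// => i _; rewrite asboolF// => sa; move/negP: aX; apply.
  exact/(XP sa)/sQ.
have [P Pa] := has_data_realised D a.
have [i Pi] := s_surj P (proj2 (XP Pa) aX).
have ia : has_data D (s i) a by apply/(has_data_iso (s i) Pa).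
rewrite (bigD1 i)//= asboolT// big1// => j ji; rewrite asboolF// => ja.
by move/eqP: ji; apply; apply/s_inj/(has_data_iso _ ja).
Qed.

(** Needed to keep [Z] away from its default value; one bundle is realised for each orbit that meets
    X. *)
Lemma representatives_exist : exists k (s : 'I_k -> pbundle gT M),
  representatives Q s.
Proof.
pose orb a := orbit (twist_action gT n) [set: gT * gT]%SET a.
have orbP a b : a \in orb b <-> exists u, a = twist b u.
  by split=> [/orbitP[u _ <-]|[u ->]]; [exists u|apply/orbitP; exists u].
have ex (i : 'I_#|orb @: X|) : exists P : pbundle gT M, exists a,
    [/\ a \in X, enum_val i = orb a & has_data D P a].
  have /imsetP[a aX ia] := enum_valP i.
  by have [P Pa] := has_data_realised D a; exists P, a.
have [s sP] := choice ex; exists #|orb @: X|, s; split.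
- by move=> i; have [a [aX _ sa]] := sP i; exact/(XP sa).
- move=> i j; have [a [_ ia sa]] := sP i; have [b [_ jb sb]] := sP j.
  move/(isomorphic_data sa sb)/orbP => ba; apply: enum_val_inj.
  by rewrite ia jb; apply/esym/orbit_eqP.
- move=> P PQ; have [a Pa] := has_data_exists D P.
  have aX : orb a \in orb @: X by apply/imset_f/(XP Pa).
  exists (enum_rank_in aX (orb a)).
  have [b [_ ib sb]] := sP (enum_rank_in aX (orb a)).
  apply/(isomorphic_data Pa sb)/orbP; rewrite enum_rankK_in// in ib.
  by rewrite ib; exact: orbit_refl.
Qed.

Lemma Z_count : Z Q = #|X|%:R / (#|gT| ^ 2)%:R :> R[i].
Proof.
have [k [s sQ]] := representatives_exist.
rewrite /Z; apply: xget_unique; first by exists k, s; rewrite representatives_sum.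
by move=> _ [k' [s' [sQ' ->]]]; exact: representatives_sum.
Qed.

End Counting.

(** * Bisections of the circle and of the surfaces *)

Section RealContinuity.
Variables (R : realType) (T : topologicalType).
Implicit Types f g : T -> R.

Lemma continuous_add f g : continuous f -> continuous g ->
  continuous (fun x => f x + g x).
Proof. by move=> cf cg x; apply: (@cvgD _ R); [exact: cf|exact: cg]. Qed.

Lemma continuous_mul f g : continuous f -> continuous g ->
  continuous (fun x => f x * g x).
Proof. by move=> cf cg x; apply: cvgM; [exact: cf|exact: cg]. Qed.

Lemma continuous_opp f : continuous f -> continuous (fun x => - f x).
Proof. by move=> cf x; apply: (@cvgN _ R); exact: cf. Qed.

Lemma continuous_cst (a : R) : continuous (fun _ : T => a).
Proof. by move=> x; exact: cvg_cst. Qed.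

Lemma continuous_sqrt f : continuous f -> continuous (fun x => Num.sqrt (f x)).
Proof.
move=> cf x; apply: (@continuous_comp _ _ _ f (@Num.sqrt R)); first exact: cf.
exact: sqrt_continuous.
Qed.

Lemma continuous_cap1 f : continuous f -> continuous (fun x => Num.sqrt (1 - f x ^+ 2)).
Proof.
move=> cf; apply: continuous_sqrt; apply: continuous_add; first exact: continuous_cst.
by apply: continuous_opp; exact: continuous_mul.
Qed.

(** The retraction of the line onto [a, b] when a <= b; it extends the charts below to continuous
    maps on the whole plane. *)
Definition clamp (a b x : R) := Num.max a (Num.min x b).

Lemma clamp_itv a b x : a <= b -> a <= clamp a b x <= b.
Proof. by move=> ab; rewrite le_max lexx /= ge_max ab ge_min lexx orbT. Qed.

Lemma clamp_id a b x : a <= x <= b -> clamp a b x = x.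
Proof. by move=> /andP[ax xb]; rewrite /clamp (min_idPl xb) (max_idPr ax). Qed.

Lemma continuous_clamp f g h : continuous f -> continuous g -> continuous h ->
  continuous (fun x => clamp (f x) (g x) (h x)).
Proof.
move=> cf cg ch x.
apply: (@continuous_max _ _ f (fun x => Num.min (h x) (g x))); first exact: cf.
by apply: (@continuous_min _ _ h g); [exact: ch|exact: cg].
Qed.

End RealContinuity.

Section Charts.
Variable R : realType.
Local Notation plane := (R * R)%type.

Section ChartsBisection.
Variables (M : topologicalType) (n : nat) (half : bool -> set M)
  (chart : bool -> plane -> M) (coord : M -> plane)
  (arcs : 'I_n -> set M) (arc_chart : 'I_n -> plane -> M).
Hypothesis closed_half : forall b, closed (half b).
Hypothesis half_cover : forall x, half true x \/ half false x.
Hypothesis chart_continuous : forall b, continuous (chart b).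
Hypothesis chart_half : forall b z, half b (chart b z).
Hypothesis coord_continuous : continuous coord.
Hypothesis coord_rect : forall x, rect (-1) 1 (-1) 1 (coord x).
Hypothesis chartK : forall b x, half b x -> chart b (coord x) = x.
Hypothesis closed_arcs : forall i, closed (arcs i).
Hypothesis arc_chart_continuous : forall i, continuous (arc_chart i).
Hypothesis range_arc_chart : forall i, range (arc_chart i) = arcs i.
Hypothesis arcs_inj : forall i j x, arcs i x -> arcs j x -> i = j.
Hypothesis halfI : half true `&` half false = \bigcup_i arcs i.

Let range_connected (h : plane -> M) : continuous h -> connected (range h).
Proof.
move=> ch; apply: connected_continuous_connected; first exact: connected_plane.
exact: continuous_subspaceT.
Qed.

Let half_range b : half b = range (chart b).
Proof.
rewrite eqEsubset; split=> [x bx|_ [z _ <-]]; last exact: chart_half.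
by exists (coord x) => //; exact: chartK.
Qed.

Let half_connected b : connected (half b).
Proof. by rewrite half_range; exact: range_connected. Qed.

Let half_nonempty b : half b !=set0.
Proof. by exists (chart b (0, 0)). Qed.

Let half_section b gT (P : pbundle gT M) : exists s : M -> P, is_lift id (half b) s.
Proof.
have N11 : (-1 : R) <= 1 by rewrite (le_trans (lerN10 _)).
apply: (chart_section P (@chart_continuous b) N11 N11 coord_continuous) => x bx.
by split => //; exact: chartK.
Qed.

Let halfU : half true `|` half false = setT.
Proof. by rewrite eqEsubset; split=> // x _; exact: half_cover. Qed.

Let arcs_connected i : connected (arcs i).
Proof. by rewrite -range_arc_chart; exact: range_connected. Qed.

Let arcs_nonempty i : arcs i !=set0.
Proof. by rewrite -range_arc_chart; exists (arc_chart i (0, 0)), (0, 0). Qed.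

(** Each half is a retract of the plane: it is the image of [chart b], hence connected, and [coord]
    embeds it in the square [-1, 1]^2 with [chart b] as left inverse, hence it carries a section by
    [chart_section]. *)
Definition charts_bisection : bisection M n :=
  Bisection (@closed_half true) (@closed_half false) halfU
    (@half_connected true) (@half_connected false) (half_nonempty true)
    (half_nonempty false) closed_arcs arcs_connected arcs_nonempty arcs_inj
    halfI (half_section true) (half_section false).

End ChartsBisection.
End Charts.

(** * The circle as two half circles *)

Section CircleBisection.
Variable R : realType.
Implicit Types (z : circle R) (b : bool).

Definition sg b : R := if b then 1 else -1.

Lemma sgM b : sg b * sg b = 1.
Proof. by case: b; rewrite /sg ?mulr1// mulrNN mulr1. Qed.

Lemma sg_sqrt b x y : 0 <= sg b * x -> y = x ^+ 2 -> sg b * Num.sqrt y = x.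
Proof.
move=> bx ->; rewrite sqrtr_sqr; case: b bx; rewrite /sg ?mul1r ?mulN1r => bx.
  exact: ger0_norm.
by rewrite ler0_norm ?opprK// -oppr_ge0.
Qed.

Lemma sqr_sg_sqrt b x : 0 <= x -> (sg b * Num.sqrt x) ^+ 2 = x.
Proof. by move=> x0; rewrite exprMn expr2 sgM mul1r sqr_sqrtr. Qed.

Lemma sqr_le1 (x : R) : -1 <= x <= 1 -> 0 <= 1 - x ^+ 2.
Proof. by move=> /andP[? ?]; nra. Qed.

Lemma le1_sqr (x y : R) : x ^+ 2 + y ^+ 2 <= 1 -> -1 <= x <= 1.
Proof. by move=> h; apply/andP; split; nra. Qed.

Lemma circle_coordP z : -1 <= (\val z).1 <= 1 /\ -1 <= (\val z).2 <= 1.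
Proof.
by have h := circleE z; split; [apply: (@le1_sqr _ (\val z).2)|
  apply: (@le1_sqr _ (\val z).1); rewrite addrC]; rewrite h.
Qed.

Lemma clamp1P (x : R) : -1 <= clamp (-1) 1 x <= 1.
Proof. by apply: clamp_itv; rewrite (le_trans (lerN10 _)). Qed.

Lemma circle_chart_subproof b (x : R) :
  (clamp (-1) 1 x, sg b * Num.sqrt (1 - clamp (-1) 1 x ^+ 2)) \in @circle_set R.
Proof.
apply/mem_set; rewrite /circle_set/= sqr_sg_sqrt; first by rewrite addrC subrK.
by apply: sqr_le1; exact: clamp1P.
Qed.

Definition circle_chart b (x : R) : circle R :=
  exist (fun p => p \in @circle_set R) _ (circle_chart_subproof b x).

Lemma circle_chart_continuous b : continuous (circle_chart b).
Proof.
apply: (@continuous_comp_initial _ _ _ (fun z : circle R => \val z)) => x.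
have cc : continuous (clamp (-1 : R) 1).
  by apply: continuous_clamp; [exact: continuous_cst|exact: continuous_cst|move=> y; exact: cvg_id].
apply: (@continuous_pair _ _ _ (clamp (-1) 1)); first exact: cc.
by apply: continuous_mul; [exact: continuous_cst|exact: continuous_cap1].
Qed.

Definition circle_half b : set (circle R) := [set z | 0 <= sg b * (\val z).2].

Lemma circle_chart_half b x : circle_half b (circle_chart b x).
Proof. by rewrite /circle_half/= mulrA sgM mul1r sqrtr_ge0. Qed.

Lemma circle_chartK b z : circle_half b z -> circle_chart b (\val z).1 = z.
Proof.
move=> bz; apply: val_inj => /=; rewrite clamp_id; last by have [] := circle_coordP z.
rewrite (sg_sqrt bz); first by rewrite -surjective_pairing.
by rewrite -(circleE z) addrAC subrr add0r.
Qed.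

Lemma closed_circle_half b : closed (circle_half b).
Proof.
apply: (@closed_comp _ _ (fun z : circle R => sg b * (\val z).2) [set x | 0 <= x]).
  move=> z _; apply: continuous_mul; first exact: continuous_cst.
  exact: circle_snd_continuous.
exact: closed_ge.
Qed.

Lemma circle_half_cover z : circle_half true z \/ circle_half false z.
Proof.
rewrite /circle_half/= mul1r mulN1r oppr_ge0.
by case: (leP 0 (\val z).2) => h; [left|right; exact: ltW].
Qed.

(* The points (1, 0) for i = 0 and (-1, 0) for i = 1. *)
Definition circle_arc (i : 'I_2) : set (circle R) :=
  [set z | (\val z).1 = sg (i == ord0)].

Lemma closed_circle_arc i : closed (circle_arc i).
Proof.
apply: (@closed_comp _ _ (fun z : circle R => (\val z).1) [set x | x = sg (i == ord0)]).
  by move=> z _; exact: circle_fst_continuous.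
exact: closed_eq.
Qed.

Lemma circle_arc_snd i z : circle_arc i z -> (\val z).2 = 0.
Proof.
rewrite /circle_arc/= => zi; have := circleE z; rewrite zi expr2 sgM => /eqP.
by rewrite -subr_eq0 addrAC subrr add0r sqrf_eq0 => /eqP.
Qed.

Lemma circle_arc_half i z b : circle_arc i z -> circle_half b z.
Proof. by move=> /circle_arc_snd; rewrite /circle_half/= => ->; rewrite mulr0. Qed.

Lemma circle_arc_chart i : circle_arc i (circle_chart true (sg (i == ord0))).
Proof.
rewrite /circle_arc/= clamp_id//; case: (i == ord0); rewrite /sg ?lexx ?andbT;
  by rewrite (le_trans (lerN10 _)).
Qed.

Lemma circle_arcE i : circle_arc i = [set circle_chart true (sg (i == ord0))].
Proof.
rewrite eqEsubset; split=> [z iz|_ ->]; last exact: circle_arc_chart.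
by rewrite /= -(circle_chartK (circle_arc_half true iz)); congr circle_chart.
Qed.

Lemma circle_arc_inj i j z : circle_arc i z -> circle_arc j z -> i = j.
Proof.
rewrite /circle_arc/= => -> /eqP; rewrite /sg => ij; apply: val_inj.
move: i j ij => [[|[|//]] ?] [[|[|//]] ?] //=.
  by move=> /eqP h; exfalso; lra.
by move=> /eqP h; exfalso; lra.
Qed.

Lemma circle_halfI : circle_half true `&` circle_half false = \bigcup_i circle_arc i.
Proof.
rewrite eqEsubset; split=> [z|z [i _ zi]]; last by split; exact: circle_arc_half zi.
rewrite /circle_half/= mul1r mulN1r oppr_ge0 => -[h1 h2].
have z2 : (\val z).2 = 0 by apply/le_anti/andP.
have := circleE z; rewrite z2 [0 ^+ 2]expr2 mulr0 addr0 => /eqP; rewrite sqrf_eq1.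
by move=> /orP[] /eqP z1; [exists ord0|exists (inord 1)]; rewrite // /circle_arc/= z1
  /sg//= ifF//; apply/eqP => /(congr1 val); rewrite /= inordK.
Qed.

Lemma circle_rect (z : circle R) : rect (-1) 1 (-1) 1 ((\val z).1, 0 : R).
Proof.
rewrite /rect/=; have [-> _] := circle_coordP z.
by rewrite lerN10 ler01.
Qed.

(** The half circles are graphs over the first coordinate; making the charts constant in the second
    one fits them into the planar setting. The arcs are single points. *)
Definition circle_bisection : bisection (circle R) 2.
Proof.
refine (@charts_bisection R (circle R) 2 circle_half
  (fun b x => circle_chart b x.1) (fun z => ((\val z).1, 0)) circle_arc
  (fun i _ => circle_chart true (sg (i == ord0)))
  closed_circle_half circle_half_cover _ _ _ circle_rect _ closed_circle_arc _ _
  circle_arc_inj circle_halfI).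
- move=> b x; apply: (@continuous_comp _ _ _ fst (circle_chart b)).
    exact: cvg_fst.
  exact: circle_chart_continuous.
- by move=> b x; exact: circle_chart_half.
- move=> z; apply: (@continuous_pair _ _ _ (fun z : circle R => (\val z).1)).
    exact: circle_fst_continuous.
  exact: cst_continuous.
- by move=> b z; exact: circle_chartK.
- by move=> i z; exact: cst_continuous.
- move=> i; rewrite circle_arcE eqEsubset; split=> [_ [z _ <-]//|_ ->].
  by exists (0, 0).
Defined.

End CircleBisection.

(** * The disc, the cylinder and the trinion *)

Section SurfaceBisections.
Variable R : realType.
Local Notation plane := (R * R)%type.
Implicit Types (b : bool) (w : plane).

Lemma sqrt_itv (s y : R) : y ^+ 2 <= s -> - Num.sqrt s <= y <= Num.sqrt s.
Proof.
by move=> ys; rewrite -ler_norml -sqrtr_sqr ler_wsqrtr.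
Qed.

Lemma sqr_le_of_itv (s y : R) : 0 <= s -> - Num.sqrt s <= y <= Num.sqrt s -> y ^+ 2 <= s.
Proof.
move=> s0 /andP[ly yl]; rewrite -(sqr_sqrtr s0).
by set h := Num.sqrt s in ly yl *; nra.
Qed.

Lemma fst_continuous : continuous (fun w : plane => w.1).
Proof. by move=> w; exact: cvg_fst. Qed.

Lemma snd_continuous : continuous (fun w : plane => w.2).
Proof. by move=> w; exact: cvg_snd. Qed.

Lemma pair_continuous (T : topologicalType) (f g : T -> R) :
  continuous f -> continuous g -> continuous (fun x => (f x, g x)).
Proof. by move=> cf cg x; apply: continuous_pair; [exact: cf|exact: cg]. Qed.

Lemma sqr_itv1 (x y : R) : x ^+ 2 + y ^+ 2 <= 1 -> rect (-1) 1 (-1) 1 (x, y).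
Proof.
move=> xy; apply/andP; split; first exact: le1_sqr xy.
by apply: (@le1_sqr _ _ x); rewrite addrC.
Qed.

(* The disc needs no cutting: both halves and the only arc are the whole disc. *)
Lemma disc_chart_subproof w :
  (clamp (-1) 1 w.1, clamp (- Num.sqrt (1 - clamp (-1) 1 w.1 ^+ 2))
    (Num.sqrt (1 - clamp (-1) 1 w.1 ^+ 2)) w.2) \in @disc_set R.
Proof.
apply/mem_set; rewrite /disc_set/=; set x := clamp (-1) _ _; set h := Num.sqrt _.
have x1 : 0 <= 1 - x ^+ 2 by apply: sqr_le1; exact: clamp1P.
have /(sqr_le_of_itv x1) : - h <= clamp (- h) h w.2 <= h.
  by apply: clamp_itv; have := sqrtr_ge0 (1 - x ^+ 2); rewrite -/h; lra.
by rewrite lerBrDl.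
Qed.

Definition disc_chart w : disc R :=
  exist (fun p => p \in @disc_set R) _ (disc_chart_subproof w).

Definition disc_coord (p : disc R) : plane := \val p.

Lemma disc_chart_continuous : continuous disc_chart.
Proof.
apply: (@continuous_comp_initial _ _ _ (fun p : @disc_set R => \val p)).
have cc : continuous (fun w : plane => clamp (-1) 1 w.1).
  by apply: continuous_clamp; [exact: continuous_cst|exact: continuous_cst|
      exact: fst_continuous].
have ch := continuous_cap1 cc.
apply: pair_continuous => //; apply: continuous_clamp => //; last exact: snd_continuous.
exact: continuous_opp.
Qed.

Lemma disc_coord_continuous : continuous disc_coord.
Proof. exact: initial_continuous. Qed.

Lemma disc_chartK p : disc_chart (disc_coord p) = p.
Proof.
case: p => [[x y] pxy]; have : disc_set (x, y) := set_mem pxy.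
rewrite /disc_set/= => xy; apply: val_inj => /=.
have xI : -1 <= x <= 1 by exact: le1_sqr xy.
by rewrite [clamp (-1) 1 x]clamp_id// clamp_id//=; apply: sqrt_itv; rewrite lerBrDl.
Qed.

Definition disc_bisection : bisection (disc R) 1.
Proof.
refine (@charts_bisection R (disc R) 1 (fun _ => setT) (fun _ => disc_chart)
  disc_coord (fun _ => setT) (fun _ => disc_chart) _ _ _ _ _ _ _ _ _ _ _ _).
- by move=> _; exact: closedT.
- by left.
- by move=> _; exact: disc_chart_continuous.
- by [].
- exact: disc_coord_continuous.
- move=> p; rewrite [disc_coord p]surjective_pairing; apply: sqr_itv1.
  exact: (set_mem (valP p)).
- by move=> _ p _; exact: disc_chartK.
- by move=> _; exact: closedT.
- by move=> _; exact: disc_chart_continuous.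
- by move=> _; rewrite eqEsubset; split=> // p _; exists (disc_coord p) => //;
    exact: disc_chartK.
- by move=> i j _ _ _; rewrite !ord1.
- by rewrite setIT eqEsubset; split=> // p _; exists ord0.
Defined.

Lemma interval_chart_subproof (t : R) : clamp 0 1 t \in @unit_interval R.
Proof. by apply/mem_set; rewrite /unit_interval/= in_itv/= clamp_itv. Qed.

Definition interval_chart (t : R) : (@unit_interval R) :=
  exist (fun p => p \in @unit_interval R) _ (interval_chart_subproof t).

Lemma interval_chart_continuous : continuous interval_chart.
Proof.
apply: (@continuous_comp_initial _ _ _ (fun p : @unit_interval R => \val p)).
by apply: continuous_clamp; [exact: continuous_cst|exact: continuous_cst|
      move=> y; exact: cvg_id].
Qed.

Lemma interval_itv (t : @unit_interval R) : 0 <= \val t <= 1.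
Proof. by have := set_mem (valP t); rewrite /unit_interval/= in_itv. Qed.

Lemma interval_chartK (t : @unit_interval R) : interval_chart (\val t) = t.
Proof. by apply: val_inj => /=; rewrite clamp_id//; exact: interval_itv. Qed.

Lemma cylinder_chart_continuous (f : plane -> circle R) :
  continuous f -> continuous (fun w => (f w, interval_chart w.2) : cylinder R).
Proof.
move=> cf w.
apply: (@continuous_pair plane (circle R) (@unit_interval R) f
  (fun w => interval_chart w.2)); first exact: cf.
apply: (@continuous_comp _ _ _ snd interval_chart); first exact: cvg_snd.
exact: interval_chart_continuous.
Qed.

Definition cylinder_half b : set (cylinder R) := [set p | circle_half b p.1].

Definition cylinder_arc (i : 'I_2) : set (cylinder R) := [set p | circle_arc i p.1].

Definition cylinder_bisection : bisection (cylinder R) 2.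
Proof.
refine (@charts_bisection R (cylinder R) 2 cylinder_half
  (fun b w => (circle_chart b w.1, interval_chart w.2))
  (fun p => ((\val p.1).1, \val p.2)) cylinder_arc
  (fun i w => (circle_chart true (sg R (i == ord0)), interval_chart w.2))
  _ _ _ _ _ _ _ _ _ _ _ _).
- move=> b; apply: (@closed_comp _ _ (fun p : cylinder R => p.1)).
    by move=> p _; exact: cvg_fst.
  exact: closed_circle_half.
- by move=> p; exact: circle_half_cover.
- move=> b; apply: cylinder_chart_continuous => w.
  apply: (@continuous_comp _ _ _ fst (circle_chart b)); first exact: cvg_fst.
  exact: circle_chart_continuous.
- by move=> b w; exact: circle_chart_half.
- apply: pair_continuous => p.
    apply: (@continuous_comp _ _ _ fst (fun z : circle R => (\val z).1)).
      exact: cvg_fst.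
    exact: circle_fst_continuous.
  apply: (@continuous_comp _ _ _ snd (fun t : @unit_interval R => \val t)).
    exact: cvg_snd.
  exact: initial_continuous.
- move=> p; rewrite /rect/=; have [-> _] := circle_coordP p.1.
  have /andP[t0 ->] := interval_itv p.2.
  by rewrite (le_trans (lerN10 _)).
- move=> b [z t] bz /=; congr (_, _); first exact: circle_chartK.
  exact: interval_chartK.
- move=> i; apply: (@closed_comp _ _ (fun p : cylinder R => p.1)).
    by move=> p _; exact: cvg_fst.
  exact: closed_circle_arc.
- by move=> i; apply: cylinder_chart_continuous => w; exact: cst_continuous.
- move=> i; rewrite eqEsubset; split=> [_ [w _ <-]|[z t]].
    exact: circle_arc_chart.
  rewrite /cylinder_arc/= circle_arcE => /= ->.
  by exists (0, \val t) => //=; congr (_, _); exact: interval_chartK.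
- by move=> i j p; exact: circle_arc_inj.
- rewrite eqEsubset; split=> [p|p [i _ pi]].
    move=> pp; have : (circle_half true `&` circle_half false) p.1 by [].
    by rewrite circle_halfI => -[i _ pi]; exists i.
  have : (\bigcup_i @circle_arc R i) p.1 by exists i.
  by rewrite -circle_halfI.
Defined.

(* The projection (x, y, z) |-> (x, y) embeds each of the halves z >= 0 and
   z <= 0 of the trinion as a convex subset of the plane, onto which the plane
   is retracted by clamping x and then y. *)
Definition trinion_x w : R := clamp (- (4 / 5)) (4 / 5) w.1.
Definition trinion_h w : R := Num.sqrt (1 - trinion_x w ^+ 2).
Definition trinion_y w : R := clamp (- trinion_h w) (Num.min (4 / 5) (trinion_h w)) w.2.
Definition trinion_z b w : R := sg R b * Num.sqrt (1 - trinion_x w ^+ 2 - trinion_y w ^+ 2).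

Lemma trinion_xP w : - (4 / 5) <= trinion_x w <= 4 / 5.
Proof. by apply: clamp_itv; lra. Qed.

(** The bound is 1 - (4/5)^2, from the two caps in the x direction. *)
Lemma trinion_x_sqr w : 9 / 25 <= 1 - trinion_x w ^+ 2.
Proof. by have := trinion_xP w => /andP[? ?]; nra. Qed.

Lemma trinion_yP w : - trinion_h w <= trinion_y w <= Num.min (4 / 5) (trinion_h w).
Proof.
apply: clamp_itv; rewrite le_min.
by have h0 : 0 <= trinion_h w := sqrtr_ge0 _; apply/andP; split; lra.
Qed.

Lemma trinion_y_sqr w : 0 <= 1 - trinion_x w ^+ 2 - trinion_y w ^+ 2.
Proof.
have := trinion_x_sqr w => x0; rewrite subr_ge0; apply: sqr_le_of_itv; first lra.
by have := trinion_yP w; rewrite le_min => /andP[-> /andP[_ ->]].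
Qed.

Lemma trinion_chart_subproof b w :
  (trinion_x w, trinion_y w, trinion_z b w) \in @trinion_set R.
Proof.
apply/mem_set; split => /=; last 2 first.
- exact: trinion_xP.
- by have := trinion_yP w; rewrite le_min => /andP[_ /andP[]].
- by rewrite /trinion_z sqr_sg_sqrt ?trinion_y_sqr//; ring.
Qed.

Definition trinion_chart b w : trinion R :=
  exist (fun p => p \in @trinion_set R) _ (trinion_chart_subproof b w).

Definition trinion_coord (p : trinion R) : plane := (\val p).1.

Lemma trinion_val_continuous : continuous (fun p : trinion R => \val p : R * R * R).
Proof. exact: initial_continuous. Qed.

Lemma trinion_coord_continuous : continuous trinion_coord.
Proof.
move=> p; apply: (@continuous_comp _ _ _ (fun p : trinion R => \val p : R * R * R) fst).
  exact: trinion_val_continuous.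
exact: cvg_fst.
Qed.

Lemma trinion_height_continuous : continuous (fun p : trinion R => (\val p).2).
Proof.
move=> p; apply: (@continuous_comp _ _ _ (fun p : trinion R => \val p : R * R * R) snd).
  exact: trinion_val_continuous.
exact: cvg_snd.
Qed.

Lemma trinion_chart_continuous b : continuous (trinion_chart b).
Proof.
apply: (@continuous_comp_initial _ _ _ (fun p : @trinion_set R => \val p)).
have cx : continuous trinion_x.
  by apply: continuous_clamp; [exact: continuous_cst|exact: continuous_cst|
      exact: fst_continuous].
have ch : continuous trinion_h := continuous_cap1 cx.
have cy : continuous trinion_y.
  apply: continuous_clamp; [exact: continuous_opp| |exact: snd_continuous].
  move=> w; apply: (@continuous_min _ _ (fun=> 4 / 5) trinion_h); last exact: ch.
  exact: cst_continuous.
have cz : continuous (trinion_z b).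
  apply: continuous_mul; first exact: continuous_cst.
  apply: continuous_sqrt; apply: continuous_add; last first.
    by apply: continuous_opp; exact: continuous_mul.
  apply: continuous_add; first exact: continuous_cst.
  by apply: continuous_opp; exact: continuous_mul.
move=> w; apply: (@continuous_pair _ _ _ (fun w => (trinion_x w, trinion_y w))).
  exact: pair_continuous.
exact: cz.
Qed.

Definition trinion_half b : set (trinion R) := [set p | 0 <= sg R b * (\val p).2].

Lemma trinion_chartK b p : trinion_half b p -> trinion_chart b (trinion_coord p) = p.
Proof.
case: p => [[[x y] z] pp]; have : trinion_set (x, y, z) := set_mem pp.
rewrite /trinion_half/= => -[/= s1 xI y45] bz; apply: val_inj => /=.
rewrite /trinion_z /trinion_y /trinion_h /trinion_x /trinion_coord /=.
rewrite [clamp (- (4 / 5)) _ _]clamp_id//.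
have /sqrt_itv/andP[y1 y2] : y ^+ 2 <= 1 - x ^+ 2 by nra.
rewrite [clamp _ _ y]clamp_id; last by rewrite le_min y1 y45 y2.
by congr (_, _); apply: sg_sqrt => //; rewrite -s1; ring.
Qed.

(* The equator z = 0 meets the trinion in three arcs: the one between the caps
   x > 4/5 and y > 4/5, the one between the caps x < -4/5 and y > 4/5, and the
   one between the caps x < -4/5 and x > 4/5. *)
Definition trinion_arc (i : 'I_3) : set (trinion R) :=
  [set p | (\val p).2 = 0 /\
    if i == 0%N :> nat then 3 / 5 <= (\val p).1.1 /\ 0 <= (\val p).1.2
    else if i == 1%N :> nat then (\val p).1.1 <= - (3 / 5) /\ 0 <= (\val p).1.2
    else (\val p).1.2 <= - (3 / 5)].

(** The second coordinate 1 or -1 is clamped to the largest or smallest y allowed over x. For i = 0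
    and 1 the range of x ensures that this top point lies on the equator and not inside the edge y =
    4/5 of the cap. *)
Definition trinion_arc_chart (i : 'I_3) w : trinion R :=
  trinion_chart true
    (if i == 0%N :> nat then (clamp (3 / 5) (4 / 5) w.1, 1)
     else if i == 1%N :> nat then (clamp (- (4 / 5)) (- (3 / 5)) w.1, 1)
     else (w.1, -1)).

(** For |x| >= 3/5 the height sqrt(1 - x^2) is at most 4/5, so the unit circle and not the cap
    bounds y from above. *)
Lemma trinion_chart_top (x : R) : 9 / 25 <= x ^+ 2 -> - (4 / 5) <= x <= 4 / 5 ->
  [/\ trinion_x (x, 1) = x, trinion_y (x, 1) = Num.sqrt (1 - x ^+ 2) &
      trinion_z true (x, 1) = 0].
Proof.
move=> x2 xI; have x1 : 0 <= 1 - x ^+ 2 by nra.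
have ex : trinion_x (x, 1) = x by rewrite /trinion_x clamp_id.
have ey : trinion_y (x, 1) = Num.sqrt (1 - x ^+ 2).
  rewrite /trinion_y /trinion_h ex /clamp /=.
  have h0 := sqrtr_ge0 (1 - x ^+ 2); have h2 := sqr_sqrtr x1.
  set h := Num.sqrt _ in h0 h2 *.
  have h45 : h <= 4 / 5 by nra.
  by rewrite (min_idPr h45) min_r ?max_r//; lra.
by split=> //; rewrite /trinion_z ex ey sqr_sqrtr// subrr sqrtr0 mulr0.
Qed.

Lemma trinion_chart_bottom (x : R) : - (4 / 5) <= x <= 4 / 5 ->
  [/\ trinion_x (x, -1) = x, trinion_y (x, -1) = - Num.sqrt (1 - x ^+ 2) &
      trinion_z true (x, -1) = 0].
Proof.
move=> xI; have x1 : 0 <= 1 - x ^+ 2 by move/andP: xI => [? ?]; nra.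
have ex : trinion_x (x, -1) = x by rewrite /trinion_x clamp_id.
have ey : trinion_y (x, -1) = - Num.sqrt (1 - x ^+ 2).
  rewrite /trinion_y /trinion_h ex /clamp /=.
  have h0 := sqrtr_ge0 (1 - x ^+ 2); have h2 := sqr_sqrtr x1.
  set h := Num.sqrt _ in h0 h2 *.
  have h1 : h <= 1 by nra.
  by rewrite min_l ?max_l ?le_min//; [lra|apply/andP; split; lra].
by split=> //; rewrite /trinion_z ex ey sqrrN sqr_sqrtr// subrr sqrtr0 mulr0.
Qed.

Lemma range_trinion_arc_chart i : range (trinion_arc_chart i) = trinion_arc i.
Proof.
rewrite eqEsubset /trinion_arc_chart /trinion_arc; split=> [_ [w _ <-]|p].
- case: ifP => _; [|case: ifP => _]; rewrite /=.
  + have /andP[? ?] : 3 / 5 <= clamp (3 / 5) (4 / 5) w.1 <= 4 / 5.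
      by apply: clamp_itv; lra.
    have [||-> -> ->] := @trinion_chart_top (clamp (3 / 5) (4 / 5) w.1).
    * by nra.
    * by apply/andP; split; lra.
    * by rewrite sqrtr_ge0.
  + have /andP[? ?] : - (4 / 5) <= clamp (- (4 / 5)) (- (3 / 5)) w.1 <= - (3 / 5).
      by apply: clamp_itv; lra.
    have [||-> -> ->] := @trinion_chart_top (clamp (- (4 / 5)) (- (3 / 5)) w.1).
    * by nra.
    * by apply/andP; split; lra.
    * by rewrite sqrtr_ge0.
  + have xx : trinion_x (trinion_x w, -1) = trinion_x (w.1, -1).
      by rewrite [LHS]clamp_id//; exact: trinion_xP.
    have yy : trinion_y (w.1, -1) = trinion_y (trinion_x w, -1).
      by rewrite /trinion_y /trinion_h xx.
    have zz : trinion_z true (w.1, -1) = trinion_z true (trinion_x w, -1).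
      by rewrite /trinion_z yy xx.
    have [_ ey ez] := trinion_chart_bottom (trinion_xP w).
    rewrite yy zz ey ez; split => //.
    have x2 := trinion_x_sqr w; have h0 := sqrtr_ge0 (1 - trinion_x w ^+ 2).
    have h2 : Num.sqrt (1 - trinion_x w ^+ 2) ^+ 2 = 1 - trinion_x w ^+ 2.
      by apply: sqr_sqrtr; lra.
    by set h := Num.sqrt _ in h0 h2 *; nra.
- case: p => [[[x y] z] pp]; have [/= s1 xI y45] : trinion_set (x, y, z) := set_mem pp.
  have top : z = 0 -> 0 <= y -> 9 / 25 <= x ^+ 2 ->
      trinion_chart true (x, 1) = exist _ (x, y, z) pp.
    move=> z0 y0 x2; apply: val_inj; have [ex ey ez] := trinion_chart_top x2 xI.
    rewrite /= ex ey ez z0 (_ : 1 - x ^+ 2 = y ^+ 2) ?sqrtr_sqr ?ger0_norm//.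
    by rewrite -s1 z0; ring.
  have bot : z = 0 -> y <= 0 -> trinion_chart true (x, -1) = exist _ (x, y, z) pp.
    move=> z0 y0; apply: val_inj; have [ex ey ez] := trinion_chart_bottom xI.
    rewrite /= ex ey ez z0 (_ : 1 - x ^+ 2 = y ^+ 2).
      by rewrite sqrtr_sqr ler0_norm// opprK.
    by rewrite -s1 z0; ring.
  have /andP[xl xr] := xI.
  case: ifP => _; [|case: ifP => _] => /= -[z0].
  + move=> [x0 y0]; exists (x, 0) => //=.
    by rewrite clamp_id ?x0// top//; nra.
  + move=> [x0 y0]; exists (x, 0) => //=.
    by rewrite clamp_id ?x0 ?xl// top//; nra.
  + by move=> y0; exists (x, 0) => //=; rewrite bot//; lra.
Qed.

Lemma trinion_xy_continuous :
  continuous (fun p : trinion R => (\val p).1.1) /\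
  continuous (fun p : trinion R => (\val p).1.2).
Proof.
split=> p.
  apply: (@continuous_comp _ _ _ trinion_coord fst); last exact: cvg_fst.
  exact: trinion_coord_continuous.
apply: (@continuous_comp _ _ _ trinion_coord snd); last exact: cvg_snd.
exact: trinion_coord_continuous.
Qed.

Lemma closed_trinion_arc i : closed (trinion_arc i).
Proof.
have [cx cy] := trinion_xy_continuous; have cz := trinion_height_continuous.
have cle (f : trinion R -> R) a : continuous f -> closed [set p | f p <= a].
  by move=> cf; apply: (@closed_comp _ _ f [set x | x <= a]) => //; exact: closed_le.
have cge (f : trinion R -> R) a : continuous f -> closed [set p | a <= f p].
  by move=> cf; apply: (@closed_comp _ _ f [set x | a <= x]) => //; exact: closed_ge.
have ceq : closed [set p : trinion R | (\val p).2 = 0].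
  apply: (@closed_comp _ _ (fun p : trinion R => (\val p).2) [set x | x = 0]).
    by move=> p _; exact: cz.
  exact: closed_eq.
rewrite /trinion_arc.
case: (nat_of_ord i == 0%N) => [|]; last case: (nat_of_ord i == 1%N) => [|].
- exact: (@closedI _ _ _ ceq (@closedI _ _ _ (cge _ _ cx) (cge _ _ cy))).
- exact: (@closedI _ _ _ ceq (@closedI _ _ _ (cle _ _ cx) (cge _ _ cy))).
- exact: (@closedI _ _ _ ceq (cle _ _ cy)).
Qed.

(** On the equator x^2 + y^2 = 1. If y >= 0 then y <= 4/5 forces |x| >= 3/5, and the sign of x
    selects the arc; if y < 0 then |x| <= 4/5 forces y <= -3/5. *)
Lemma trinion_halfI : trinion_half true `&` trinion_half false = \bigcup_i trinion_arc i.
Proof.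
rewrite eqEsubset; split=> [p|p [i _ [z0 _]]]; last first.
  by rewrite /trinion_half/= z0 !mulr0.
rewrite /trinion_half/= mul1r mulN1r oppr_ge0 => -[h1 h2].
have z0 : (\val p).2 = 0 by apply/le_anti/andP.
have [s1 /andP[xl xr] y45] := set_mem (valP p).
rewrite z0 in s1.
have [y0|y0] := leP 0 (\val p).1.2; last first.
  by exists (inord 2) => //; split => //; rewrite inordK//=; nra.
have [x0|x0] := leP 0 (\val p).1.1.
  by exists (inord 0) => //; split => //; rewrite inordK//=; split => //; nra.
by exists (inord 1) => //; split => //; rewrite inordK//=; split => //; nra.
Qed.

Definition trinion_bisection : bisection (trinion R) 3.
Proof.
refine (@charts_bisection R (trinion R) 3 trinion_half trinion_chart
  trinion_coord trinion_arc trinion_arc_chart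
  _ _ trinion_chart_continuous _ trinion_coord_continuous _ trinion_chartK
  closed_trinion_arc _ range_trinion_arc_chart _ trinion_halfI).
- move=> b; apply: (@closed_comp _ _ (fun p : trinion R => sg R b * (\val p).2)
    [set x | 0 <= x]); last exact: closed_ge.
  move=> p _; apply: continuous_mul; first exact: continuous_cst.
  exact: trinion_height_continuous.
- move=> p; rewrite /trinion_half/= mul1r mulN1r oppr_ge0.
  by case: (leP 0 (\val p).2) => h; [left|right; exact: ltW].
- by move=> b w; rewrite /trinion_half/= /trinion_z mulrA sgM mul1r sqrtr_ge0.
- move=> p; rewrite [trinion_coord p]surjective_pairing; apply: sqr_itv1.
  by have [s1 _ _] := set_mem (valP p); rewrite -s1 lerDl sqr_ge0.
- have cclamp (a b : R) : continuous (fun w : plane => clamp a b w.1).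
    by apply: continuous_clamp; [exact: continuous_cst|exact: continuous_cst|
      exact: fst_continuous].
  have carc (f : plane -> plane) : continuous f -> continuous (trinion_chart true \o f).
    move=> cf w; apply: (@continuous_comp _ _ _ f (trinion_chart true)).
      exact: cf.
    exact: trinion_chart_continuous.
  move=> i; rewrite /trinion_arc_chart.
  case: (nat_of_ord i == 0%N) => [|]; last case: (nat_of_ord i == 1%N) => [|];
    apply: carc; apply: pair_continuous;
    by [exact: cclamp|exact: fst_continuous|exact: continuous_cst].
- move=> i j p [_ pi] [_ pj]; apply: val_inj; move: pi pj.
  by case: i => [[|[|[|//]]] ?]; case: j => [[|[|[|//]]] ?] //=;
    move=> ? ?; exfalso; intuition lra.
Defined.

End SurfaceBisections.

(** * Holonomy *)

Section PullbackLifts.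
Variable gT : finGroupType.

Lemma proj_surj (B : topologicalType) (P : pbundle gT B) b : exists p : P, proj p = b.
Proof.
have [U [phi [psi [_ Ub [_ _ _ _ psiK]]]]] := locally_trivial P b.
by exists (psi (b, 1%g)); have [] := psiK (b, 1%g : discrete_topology gT) Ub.
Qed.

Lemma is_lift_comp (B T T' : topologicalType) (P : pbundle gT B) (f : T -> B)
    (h : T' -> T) (A : set T) (A' : set T') (s : T -> P) :
  continuous h -> (forall x, A' x -> A (h x)) -> is_lift f A s ->
  is_lift (f \o h) A' (s \o h).
Proof.
move=> ch hA [/subspace_continuousP cs ps]; split; last by move=> x /hA /ps.
apply/subspace_continuousP => x Ax.
apply: (@cvg_comp _ _ _ h s _ _ _ _ (cs _ (hA _ Ax))) => N; rewrite /within/= => nN.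
have hN : nbhs x (h @^-1` _) := ch x _ nN.
by apply: filterS hN => y /= yN Ay; apply: yN; exact: hA.
Qed.

Variables (A B T : topologicalType) (f : A -> B) (cf : continuous f).
Variables (P : pbundle gT B) (h : T -> A) (E : set T).

Lemma lift_to_pullback (s : T -> P) : continuous h -> is_lift (f \o h) E s ->
  exists s' : T -> pullback cf P, is_lift h E s' /\
    forall x, E x -> (\val (s' x)).2 = s x.
Proof.
move=> ch [/subspace_continuousP cs ps].
have ex x : exists y : pullback cf P, proj y = h x /\ (E x -> (\val y).2 = s x).
  have [Ex|nEx] := pselect (E x); last first.
    by have [y yx] := proj_surj (pullback cf P) (h x); exists y.
  have yP : (h x, s x) \in @pullback_set gT A B f P by apply/mem_set; rewrite /pullback_set/= ps.
  by exists (exist (fun z => z \in @pullback_set gT A B f P) _ yP).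
have [s' s'P] := choice ex.
have vE x : E x -> \val (s' x) = (h x, s x).
  move=> Ex; have [hx sx] := s'P x.
  by rewrite [LHS]surjective_pairing sx//; congr (_, _).
exists s'; split; last by move=> x Ex; have [_] := s'P x; exact.
split; last by move=> x _; have [] := s'P x.
apply/subspace_continuousP => x Ex N.
rewrite nbhsE /= => -[V [[W oW <-] VW] VN].
have chs : (fun y => (h y, s y)) @ within E (nbhs x) --> (h x, s x).
  by apply: cvg_pair; [apply: cvg_within_filter; exact: ch|exact: cs].
have nW : nbhs (h x, s x) W.
  by apply: open_nbhs_nbhs; split => //; rewrite -vE.
have xW : within E (nbhs x) _ := chs _ nW.
suff : within E (nbhs x) (s' @^-1` N) by [].
apply: filterS (filterI (withinT E _) xW) => y [Ey Wy].
by apply: VN; rewrite /preimage/= -[set_val _]/(\val _) vE.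
Qed.

Lemma lift_of_pullback (s : T -> pullback cf P) : is_lift h E s ->
  is_lift (f \o h) E (fun x => (\val (s x)).2).
Proof.
move=> [/subspace_continuousP cs ps]; split.
  apply/subspace_continuousP => x Ex.
  apply: (@cvg_comp _ _ _ s (fun y : pullback cf P => (\val y).2) _ _ _ (cs x Ex)).
  exact: pullback_snd_continuous.
move=> x Ex; rewrite /= -(ps x Ex).
by have := set_mem (valP (s x)); rewrite /pullback_set/= => ->.
Qed.

End PullbackLifts.

Section DataPullback.
Variables (gT : finGroupType) (T B : topologicalType) (n : nat).
Variables (D : bisection T n) (f : T -> B) (cf : continuous f).
Implicit Types (P : pbundle gT B) (a : {ffun 'I_n -> gT}).

Definition is_frame_along P (s t : T -> P) a : Prop :=
  [/\ is_lift f (upper D) s, is_lift f (lower D) t &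
      forall i x, arc D i x -> t x = pact (s x) (a i)].

(** Data of a pullback are read off from lifts of f into P itself, so that later computations avoid
    the points of the pullback. *)
Lemma has_data_pullback P a :
  has_data D (pullback cf P) a <-> exists s t : T -> P, is_frame_along s t a.
Proof.
have cid : continuous (id : T -> T) by move=> x; exact: cvg_id.
split=> [[s [t [ls lt st]]]|[s [t [ls lt st]]]].
  exists (fun x => (\val (s x)).2), (fun x => (\val (t x)).2); split.
  - exact: lift_of_pullback ls.
  - exact: lift_of_pullback lt.
  - by move=> i x ax; rewrite (st i).
have [s' [ls' ss']] := lift_to_pullback cf cid ls.
have [t' [lt' tt']] := lift_to_pullback cf cid lt.
exists s', t'; split => // i x ax.
have ux := arc_upper ax; have lx := arc_lower ax.
apply: val_inj; apply: injective_projections => /=.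
  by rewrite -[LHS]/(proj (t' x)) -[RHS]/(proj (s' x)) lt'.2// ls'.2.
by rewrite tt'// ss'// (st i).
Qed.

Lemma is_frame_along_push P (Q : pbundle gT B) (F : P -> Q) (s t : T -> P) a :
  bundle_iso F -> is_frame_along s t a -> is_frame_along (F \o s) (F \o t) a.
Proof.
move=> FI [ls lt st]; split; [exact: is_lift_push ls|exact: is_lift_push lt|].
by have [_ _ FM _] := FI; move=> i x ax /=; rewrite (st i)// FM.
Qed.

End DataPullback.

Section Holonomy.
Variables (R : realType) (gT : finGroupType).
Local Notation data := {ffun 'I_2 -> gT}.
Local Notation i1 := (inord 1 : 'I_2).
Implicit Types (P : pbundle gT (circle R)) (a : data).

(* A lift of the loop follows s on the upper half circle, passes to t through
   the arc (-1, 0) and comes back to s through the arc (1, 0). *)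
Definition hol (a : data) : gT := ((a i1)^-1 * a ord0)%g.

Lemma circle_loop_continuous : continuous (@circle_loop R).
Proof.
apply: (@continuous_comp_initial _ _ _ (fun z : circle R => \val z)) => t.
have c2 : continuous (fun t : R => 2 * pi * t) by exact: mulrl_continuous.
apply: (@continuous_pair _ _ _ (fun t => cos (2 * pi * t)) (fun t => sin (2 * pi * t))).
  by apply: (@continuous_comp _ _ _ (fun t => 2 * pi * t) cos); [exact: c2|exact: continuous_cos].
by apply: (@continuous_comp _ _ _ (fun t => 2 * pi * t) sin); [exact: c2|exact: continuous_sin].
Qed.

Lemma circle_loop_upper (t : R) : 0 <= t <= 2^-1 -> upper (circle_bisection R) (circle_loop t).
Proof.
move=> /andP[t0 t2]; rewrite /upper/= /circle_half/= mul1r sin_ge0_pi//.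
have p0 := pi_gt0 R; apply/andP; split; first by rewrite !mulr_ge0// ltW.
by rewrite -[leRHS]mulr1 [2 * pi]mulrC -mulrA ler_pM2l//; lra.
Qed.

Lemma circle_loop_lower (t : R) : 2^-1 <= t <= 1 -> lower (circle_bisection R) (circle_loop t).
Proof.
move=> /andP[t2 t1]; rewrite /lower/= /circle_half/= mulN1r.
have -> : 2 * pi * t = pi * (2 * t - 1) + pi by ring.
rewrite sinDpi opprK; have p0 := pi_gt0 R; apply: sin_ge0_pi.
apply/andP; split; first by apply: mulr_ge0; [exact: ltW|lra].
by rewrite -[leRHS]mulr1 ler_pM2l//; lra.
Qed.

Lemma circle_loop_end (t : R) : t = 0 \/ t = 1 -> arc (circle_bisection R) ord0 (circle_loop t).
Proof.
move=> t01; rewrite /arc/= /circle_arc/= /sg.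
case: t01 => ->; first by rewrite mulr0 cos0.
by rewrite mulr1 mulr_natl cos2pi.
Qed.

Lemma circle_loop_mid : arc (circle_bisection R) i1 (circle_loop 2^-1).
Proof.
rewrite /arc/= /circle_arc/= /sg ifF; last by apply/eqP => /(congr1 val); rewrite /= inordK.
by rewrite mulrAC divff ?mul1r ?cospi// pnatr_eq0.
Qed.

(** A lift of the loop is [pact s g1] on the first half and [pact t h] on the second. Agreement at
    (-1, 0) gives g1 = a_1 h, and the return to (1, 0) through a_0 turns the start into its
    translate by h^-1 a_1^-1 a_0 h. *)
Lemma has_holonomy_data P a g : has_data (circle_bisection R) P a ->
  has_holonomy P g <-> exists h, g = (hol a ^ h)%g.
Proof.
move=> [s [t [ls lt st]]].
pose A1 : set R := `[0, 2^-1]%classic; pose A2 : set R := `[2^-1, 1]%classic.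
have lsU : is_lift (@circle_loop R) A1 (s \o @circle_loop R).
  apply: (is_lift_comp circle_loop_continuous _ ls) => x.
  by rewrite /A1/= in_itv; exact: circle_loop_upper.
have ltL : is_lift (@circle_loop R) A2 (t \o @circle_loop R).
  apply: (is_lift_comp circle_loop_continuous _ lt) => x.
  by rewrite /A2/= in_itv; exact: circle_loop_lower.
have A12 : `[0, 1]%classic = A1 `|` A2 :> set R.
  rewrite eqEsubset; split=> [x|x []]; rewrite /A1 /A2/= !in_itv/=.
  - by move=> /andP[x0 x1]; case: (leP x 2^-1) => h; [left|right];
      rewrite ?in_itv/= ?x0 ?x1 ?(ltW h).
  - by move=> /andP[x0 x1]; apply/andP; split; lra.
  - by move=> /andP[x0 x1]; apply/andP; split; lra.
have A1in x : A1 x -> `[0, 1]%classic x by rewrite A12; left.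
have A2in x : A2 x -> `[0, 1]%classic x by rewrite A12; right.
have mid1 : A1 2^-1 by rewrite /A1/= in_itv/=; apply/andP; split; lra.
have mid2 : A2 2^-1 by rewrite /A2/= in_itv/=; apply/andP; split; lra.
have beg1 : A1 0 by rewrite /A1/= in_itv/=; apply/andP; split; lra.
have end2 : A2 1 by rewrite /A2/= in_itv/=; apply/andP; split; lra.
have ends (gamma : R -> P) : is_lift (@circle_loop R) `[0, 1]%classic gamma ->
    exists h, gamma 1 = pact (gamma 0) (hol a ^ h)%g.
  move=> lg.
  have [g1 gs] := connected_lift_eq (@segment_connected R 0 2^-1) lsU
    (is_liftS A1in lg).
  have [h gt] := connected_lift_eq (@segment_connected R 2^-1 1) ltL
    (is_liftS A2in lg).
  exists h; rewrite (gt _ end2) (gs _ beg1) /=.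
  have : gamma 2^-1 = gamma 2^-1 by [].
  rewrite {1}(gs _ mid1) (gt _ mid2) /= (st i1 _ circle_loop_mid) -pactM.
  move=> /pact_inj ->; rewrite (st ord0); last by apply: circle_loop_end; right.
  have -> : circle_loop 1 = circle_loop 0 :> circle R.
    by apply: val_inj; rewrite /= mulr0 mulr1 !mulr_natl cos2pi sin2pi cos0 sin0.
  by rewrite -!pactM /hol conjgE !mulgA mulgK mulgV mul1g.
have itvE (x : R) : (`[0, 1]%classic x) = (0 <= x <= 1) by rewrite /= in_itv.
have isl (gamma : R -> P) : is_lift (@circle_loop R) `[0, 1]%classic gamma <->
    {within `[0, 1], continuous gamma} /\
    forall t, 0 <= t <= 1 -> proj (gamma t) = circle_loop t.
  by split=> -[cg pg]; split => // x; move: (pg x); rewrite itvE.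
split=> [[gamma [cg pg gend]]|[h ->]].
  have [h gh] := ends gamma (proj2 (isl _) (conj cg pg)).
  by exists h; apply: (@pact_inj _ _ _ (gamma 0)); rewrite -gend.
have [gamma lg] : exists gamma, is_lift (P := P) (@circle_loop R) `[0, 1]%classic gamma.
  rewrite A12; apply: is_liftU lsU ltL; try exact: interval_closed.
  suff -> : A1 `&` A2 = [set 2^-1] by exact: connected1.
  rewrite eqEsubset; split=> [x|_ ->]; last by split.
  rewrite /A1 /A2/= !in_itv/= => -[/andP[_ x2] /andP[x2' _]].
  by apply/le_anti; rewrite x2.
have [k gk] := ends gamma lg.
(* The lift found has some conjugator k; translating it by k^-1 h changes the conjugator to the
   prescribed h. *)
have [cg pg] := proj1 (isl _) (is_lift_pact (k^-1 * h)%g lg).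
exists (fun x => pact (gamma x) (k^-1 * h)%g); split => //.
by rewrite gk -!pactM; congr pact; rewrite !conjgE !mulgA !mulgK.
Qed.

Lemma holonomy_data P a : has_data (circle_bisection R) P a ->
  holonomy P = (hol a ^: [set: gT]%SET)%g.
Proof.
move=> Pa; apply/setP => g; rewrite inE; apply/asboolP/imsetP.
  by move=> /(has_holonomy_data _ Pa)[h ->]; exists h; rewrite ?inE.
by move=> [h _ ->]; apply/(has_holonomy_data _ Pa); exists h.
Qed.

Lemma ord2P (i : 'I_2) : i = ord0 \/ i = i1.
Proof.
by case: i => [[|[|//]] i2]; [left|right]; apply: val_inj; rewrite //= inordK.
Qed.

Lemma isomorphic_holonomy P P' : isomorphic P P' <-> holonomy P = holonomy P'.
Proof.
have [a Pa] := has_data_exists (circle_bisection R) P.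
have [b Pb] := has_data_exists (circle_bisection R) P'.
rewrite (isomorphic_data Pa Pb) (holonomy_data Pa) (holonomy_data Pb); split.
  move=> [u ->]; apply/esym/class_eqP/imsetP.
  by exists u.2; rewrite ?inE// /hol !ffunE/= conjgE !invMg invgK !mulgA mulgK.
move=> E; have /imsetP[h _ bh] : hol b \in (hol a ^: [set: gT]%SET)%g by rewrite E class_refl.
(* With second component h, the entry at (-1, 0) forces the first component; the entry at (1, 0)
   then follows from [hol b = hol a ^ h]. *)
exists (a i1 * h * (b i1)^-1, h)%g; apply/ffunP => i; rewrite ffunE/= !invMg invgK.
have [->|->] := ord2P i; last by rewrite -!mulgA mulKg mulVg mulg1.
rewrite -!mulgA [X in (b i1 * X)%g](_ : _ = hol b) ?mulKVg//.
by rewrite bh conjgE /hol !mulgA.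
Qed.

End Holonomy.

(** * Bundles on a disjoint union of circles *)

Section CirclesBundles.
Variables (R : realType) (gT : finGroupType) (k : nat).
Local Notation circlesT := (circles R k).
Implicit Types Q : pbundle gT circlesT.

Let circle_of (x : circlesT) : circle R := projT2 x.

Lemma circle_of_continuous : continuous circle_of.
Proof. by move=> [i z] N nN; exact: nN. Qed.

Lemma closed_circle_index i : closed [set x : circlesT | projT1 x = i].
Proof.
rewrite -[X in closed X]setCK; apply: open_closedC; rewrite openE => -[j z] ji.
change (nbhs z [set z : circle R | ~ (j = i)]).
by apply: filterS filterT => w _; exact: ji.
Qed.

(** For the converse the union is covered by its 2k closed half circles; sections of Q there and
    their images under the isomorphisms on the single circles feed [closed_cover_iso]. *)
Lemma isomorphic_circles Q Q' : isomorphic Q Q' <->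
  forall i, holonomy (circle_restriction i Q) = holonomy (circle_restriction i Q').
Proof.
pose D := circle_bisection R.
split=> [[F FI] i|QQ'].
  have [a Qa] := has_data_exists D (circle_restriction i Q).
  rewrite (holonomy_data Qa); apply/esym/holonomy_data/has_data_pullback.
  have [s [t st]] := (has_data_pullback _ _ _ _).1 Qa.
  by exists (F \o s), (F \o t); exact: is_frame_along_push.
have ex i : exists f : circle_restriction i Q -> circle_restriction i Q', bundle_iso f.
  by have /isomorphic_holonomy := QQ' i.
pose f i := projT1 (cid (ex i)).
have fI i : bundle_iso (f i) := projT2 (cid (ex i)).
have ex_s (j : 'I_k * bool) : exists s : circle R -> circle_restriction j.1 Q,
    is_lift id (circle_half j.2) s.
  case: j => i [] /=.
    exact: (upper_section (circle_bisection R) (circle_restriction i Q)).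
  exact: (lower_section (circle_bisection R) (circle_restriction i Q)).
pose s j := projT1 (cid (ex_s j)).
have ls j : is_lift id (circle_half j.2) (s j) := projT2 (cid (ex_s j)).
pose H (j : 'I_k * bool) : set circlesT :=
  [set x | projT1 x = j.1] `&` [set x | circle_half j.2 (circle_of x)].
have lift_of i b (P : pbundle gT circlesT) (r : circle R -> circle_restriction i P) :
    is_lift id (circle_half b) r ->
    is_lift id (H (i, b)) (fun x => (\val (r (circle_of x))).2 : P).
  move=> lr; have := lift_of_pullback (h := id) lr.
  have incl x : H (i, b) x -> circle_half b (circle_of x) by case.
  move=> /(is_lift_comp circle_of_continuous incl)[cr pr]; split => // x.
  by move=> Hx; rewrite (pr x Hx); case: x Hx => j z [/= <-].
have [|||||g [gI _]] := @closed_cover_iso gT circlesT ('I_k * bool)%type H _ _ Q Q'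
  (fun j x => (\val (s j (circle_of x))).2)
  (fun j x => (\val (f j.1 (s j (circle_of x)))).2).
- move=> j; apply: closedI; first exact: closed_circle_index.
  apply: (@closed_comp _ _ circle_of (circle_half j.2)).
    by move=> x _; exact: circle_of_continuous.
  exact: closed_circle_half.
- move=> [i z]; have [h|h] := circle_half_cover z; [by exists (i, true)|by exists (i, false)].
- by move=> [i b]; exact: lift_of (ls (i, b)).
- move=> [i b]; apply: (lift_of i b Q' (f i \o s (i, b))).
  by apply: is_lift_push (fI i) _; exact: ls (i, b).
- move=> [i b] [i' b'] x g [/= xi xb] [/= xi' xb'].
  have {xi'}ii' : i' = i by rewrite -xi xi'.
  subst i' => sg; have [_ _ fM _] := fI i.
  have -> : s (i, b') (circle_of x) = pact (s (i, b) (circle_of x)) g.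
    apply: val_inj; apply: injective_projections => //=.
    rewrite -[LHS]/(proj (s (i, b') (circle_of x))).
    by rewrite -[RHS]/(proj (s (i, b) (circle_of x))) (ls (i, b')).2// (ls (i, b)).2.
  by rewrite fM.
- by exists g.
Qed.

End CirclesBundles.

(** * Boundary holonomies and the values of Z on tuples of classes *)

Section BoundaryHolonomy.
Variables (R : realType) (gT : finGroupType) (M : bordered R) (n : nat).
Variable D : bisection M n.
Local Notation i1 := (inord 1 : 'I_2).
Local Notation circleD := (circle_bisection R).

Lemma boundary_data (i : 'I_(nb_circles M)) (P : pbundle gT M)
    (s t : circle R -> P) a :
  is_frame_along circleD (bcircle i) s t a ->
  has_data circleD (circle_restriction i (restriction P)) a.
Proof.
move=> [ls lt st]; apply/has_data_pullback.
pose inc : circle R -> boundary M := existT (fun _ => circle R) i.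
have cinc : continuous inc by move=> z N nN; exact: nN.
have [s' [ls' ss']] := lift_to_pullback (@boundary_map_continuous R M) cinc ls.
have [t' [lt' tt']] := lift_to_pullback (@boundary_map_continuous R M) cinc lt.
exists s', t'; split => // j z jz.
have uz := arc_upper jz; have lz := arc_lower jz.
apply: val_inj; apply: injective_projections => /=.
  by rewrite -[LHS]/(proj (t' z)) -[RHS]/(proj (s' z)) lt'.2// ls'.2.
by rewrite tt'// ss'// (st j).
Qed.

(** The parametrisation respects the cuttings of the circle and of M, so the frame of P restricts to
    a frame along the boundary circle whose data are the entries of a at the arcs met by (1, 0) and
    (-1, 0). *)
Lemma holonomy_boundary (i : 'I_(nb_circles M)) (k0 k1 : 'I_n) (P : pbundle gT M) a :
  (forall z, upper circleD z -> upper D (bcircle i z)) ->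
  (forall z, lower circleD z -> lower D (bcircle i z)) ->
  (forall z, arc circleD ord0 z -> arc D k0 (bcircle i z)) ->
  (forall z, arc circleD i1 z -> arc D k1 (bcircle i z)) ->
  has_data D P a ->
  holonomy (circle_restriction i (restriction P)) =
    (((a k1)^-1 * a k0) ^: [set: gT]%SET)%g.
Proof.
move=> uu ll a0 a1 [s [t [ls lt st]]].
have cb := @bcircle_continuous R M i.
pose c : {ffun 'I_2 -> gT} := [ffun j => if j == ord0 then a k0 else a k1].
have -> : ((a k1)^-1 * a k0)%g = hol c.
  by rewrite /hol !ffunE /= ifF//; apply/eqP => /(congr1 val); rewrite /= inordK.
apply: holonomy_data; apply: (@boundary_data i P (s \o bcircle i) (t \o bcircle i)).
split; [exact: is_lift_comp ls|exact: is_lift_comp lt|].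
move=> j z jz; rewrite ffunE; case: (ord2P j) jz => -> jz.
  by rewrite eqxx /= (st k0)//; exact: a0.
rewrite ifF /= ?(st k1)//; first exact: a1.
by apply/eqP => /(congr1 val); rewrite /= inordK.
Qed.

(** Here the parametrisation exchanges the halves: s and t trade roles along the circle, which
    inverts both entries. *)
Lemma holonomy_boundary_swap (i : 'I_(nb_circles M)) (k0 k1 : 'I_n)
    (P : pbundle gT M) a :
  (forall z, upper circleD z -> lower D (bcircle i z)) ->
  (forall z, lower circleD z -> upper D (bcircle i z)) ->
  (forall z, arc circleD ord0 z -> arc D k0 (bcircle i z)) ->
  (forall z, arc circleD i1 z -> arc D k1 (bcircle i z)) ->
  has_data D P a ->
  holonomy (circle_restriction i (restriction P)) =
    ((a k1 * (a k0)^-1) ^: [set: gT]%SET)%g.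
Proof.
move=> ul lu a0 a1 [s [t [ls lt st]]].
have cb := @bcircle_continuous R M i.
pose c : {ffun 'I_2 -> gT} := [ffun j => (if j == ord0 then a k0 else a k1)^-1]%g.
have -> : (a k1 * (a k0)^-1)%g = hol c.
  by rewrite /hol !ffunE /= ifF ?invgK//; apply/eqP => /(congr1 val); rewrite /= inordK.
apply: holonomy_data; apply: (@boundary_data i P (t \o bcircle i) (s \o bcircle i)).
split; [exact: is_lift_comp lt|exact: is_lift_comp ls|].
move=> j z jz; rewrite ffunE; case: (ord2P j) jz => -> jz.
  by rewrite eqxx /= (st k0) -?pactM ?mulgV ?pact1//; exact: a0.
rewrite ifF /= ?(st k1) -?pactM ?mulgV ?pact1//; first exact: a1.
by apply/eqP => /(congr1 val); rewrite /= inordK.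
Qed.

Variable bhol : 'I_(nb_circles M) -> {ffun 'I_n -> gT} -> gT.
Hypothesis bholP : forall (P : pbundle gT M) a, has_data D P a ->
  forall i, holonomy (circle_restriction i (restriction P)) =
    (bhol i a ^: [set: gT]%SET)%g.

Lemma class_set_eqP (c : conj_class gT) (x : gT) :
  reflect ((x ^: [set: gT]%SET)%g = class_set c) (x \in class_set c).
Proof.
apply: (iffP idP) => [|<-]; last exact: class_refl.
by rewrite /class_set; have /imsetP[y _ ->] := valP c; move/class_eqP.
Qed.

Lemma Zindex_count (c : (nb_circles M).-tuple (conj_class gT)) :
  Zindex c = #|[set a | [forall i, bhol i a \in class_set (tnth c i)]]%SET|%:R
    / (#|gT| ^ 2)%:R :> R[i].
Proof.
set X := [set a | _]%SET.
pose good (Q : pbundle gT (boundary M)) :=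
  forall i, holonomy (circle_restriction i Q) = class_set (tnth c i).
have XQ Q (P : pbundle gT M) a : good Q -> has_data D P a ->
    isomorphic (restriction P) Q <-> a \in X.
  move=> gQ Pa; rewrite isomorphic_circles inE; split=> [h|/forallP h i].
    by apply/forallP => i; apply/class_set_eqP; rewrite -(bholP Pa) h gQ.
  by rewrite (bholP Pa) gQ; exact/class_set_eqP.
have ZQ Q : good Q -> Z Q = #|X|%:R / (#|gT| ^ 2)%:R :> R[i].
  by move=> gQ; apply: (Z_count (D := D)) => P a; exact: XQ.
rewrite /Zindex /value_at.
have [[Q gQ]|noQ] := pselect (exists Q, good Q).
  apply: xget_unique; first by exists Q; rewrite ZQ.
  by move=> _ [Q' [gQ' ->]]; exact: ZQ.
(* If no Q had these holonomies the value would be the default 0. The formula would still hold: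
   every a is realised, and the restriction of its bundle would be such a Q if a were in X. *)
rewrite xgetPN; last by move=> _ [Q [gQ _]]; apply: noQ; exists Q.
suff -> : X = finset.set0 by rewrite cards0 mul0r.
apply/setP => a; rewrite finset.in_set0 inE; apply/negbTE/negP => /forallP aX.
have [P Pa] := has_data_realised D a; apply: noQ; exists (restriction P) => i.
by rewrite (bholP Pa); exact/class_set_eqP.
Qed.

End BoundaryHolonomy.

(** * Values of the theory *)

Section ConjugacyClasses.
Variable gT : finGroupType.
Implicit Types c d : conj_class gT.

Lemma class_setJ c x y : ((x ^ y)%g \in class_set c) = (x \in class_set c).
Proof.
have J u v : u \in class_set c -> (u ^ v)%g \in class_set c.
  by move/class_set_eqP <-; apply: memJ_class; rewrite inE.
by apply/idP/idP => [/(J _ y^-1%g)|/J//]; rewrite conjgK.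
Qed.

Lemma class_set_inj c d x : x \in class_set c -> x \in class_set d -> c = d.
Proof. by move=> /class_set_eqP xc /class_set_eqP xd; apply: val_inj; rewrite -[LHS]xc. Qed.

Lemma class_of_subproof (x : gT) : (x ^: [set: gT]%SET)%g \in classes [set: gT]%SET.
Proof. by apply: mem_classes; rewrite inE. Qed.

Definition class_of x : conj_class gT :=
  exist (fun A => A \in classes [set: gT]%SET) _ (class_of_subproof x).

Lemma mem_class_of x : x \in class_set (class_of x).
Proof. exact: class_refl. Qed.

Lemma class_set_ex c : exists x, x \in class_set c.
Proof.
rewrite /class_set; have /imsetP[y _ ->] := valP c.
by exists y; exact: class_refl.
Qed.

Lemma class_set_eq_sym c d x : x \in class_set c -> (x \in class_set d) = (c == d).
Proof. by move=> xc; apply/idP/eqP => [xd|<-//]; exact: class_set_inj xc xd. Qed.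

Lemma class_set_eq c d : (class_set c == class_set d) = (c == d).
Proof. by apply/eqP/eqP => [h|->//]; exact: val_inj. Qed.

Lemma class_inv_subproof c : [set x^-1%g | x in class_set c]%SET \in classes [set: gT]%SET.
Proof.
have [x xc] := class_set_ex c.
suff -> : [set x^-1%g | x in class_set c]%SET = (x^-1 ^: [set: gT]%SET)%g.
  exact: class_of_subproof.
apply/setP => y; move/class_set_eqP: xc => <-.
apply/imsetP/imsetP => [[_ /imsetP[z _ ->] ->]|[z _ ->]].
  by exists z; rewrite ?inE// conjVg.
by exists (x ^ z)%g; rewrite ?conjVg//; apply: memJ_class; rewrite inE.
Qed.

Definition class_inv c : conj_class gT :=
  exist (fun A => A \in classes [set: gT]%SET) _ (class_inv_subproof c).

Lemma mem_class_inv c x : (x \in class_set (class_inv c)) = (x^-1%g \in class_set c).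
Proof.
apply/imsetP/idP => [[y yc ->]|xc]; first by rewrite invgK.
by exists x^-1%g; rewrite ?invgK.
Qed.

Lemma class_invK : involutive class_inv.
Proof.
move=> c; have [x xc] := class_set_ex c.
by apply: (@class_set_inj _ _ x) => //; rewrite !mem_class_inv invgK.
Qed.

Lemma class_set1 c : (class_set c == [set 1%g]%SET) = (1%g \in class_set c).
Proof.
apply/eqP/idP => [->|c1]; first by rewrite finset.in_set1.
by rewrite (class_set_inj c1 (_ : 1%g \in class_set (class1 gT))) ?finset.in_set1.
Qed.

Lemma card_class_gt0 c : (0 < #|class_set c|)%N.
Proof. by have [x xc] := class_set_ex c; apply/card_gt0P; exists x. Qed.

Lemma card_class_inv c : #|class_set (class_inv c)| = #|class_set c|.
Proof. by rewrite card_imset//; exact: invg_inj. Qed.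

End ConjugacyClasses.

Lemma inord1_eq0 : ((inord 1 : 'I_2) == ord0) = false.
Proof. by rewrite -val_eqE /= inordK. Qed.

(** * Explicit counts for the three surfaces *)

Section SurfaceValues.
Variables (R : realType) (gT : finGroupType).
Local Notation C := R[i].
Implicit Types c d e : conj_class gT.

Lemma natr_card_neq0 : #|gT|%:R != 0 :> C.
Proof. by rewrite pnatr_eq0 -lt0n; apply/card_gt0P; exists 1%g. Qed.

Lemma div_sqr_card (m : nat) : (#|gT| * m)%:R / (#|gT| ^ 2)%:R = m%:R / #|gT|%:R :> C.
Proof.
rewrite natrM natrX expr2 invfM mulrACA divff ?mul1r//; exact: natr_card_neq0.
Qed.

(** Both marked points of the boundary lie on the only arc, so the holonomy word is a^-1 a. *)
Definition disc_hol (i : 'I_1) (a : {ffun 'I_1 -> gT}) : gT := 1%g.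

Lemma Z1E c : Z1 R c = (#|gT|%:R)^-1 * (class_set c == [set 1%g]%SET)%:R.
Proof.
rewrite /Z1 (@Zindex_count R gT (disc R) 1 (disc_bisection R) disc_hol).
  have -> : [set a | [forall i, disc_hol i a \in class_set (tnth [tuple c] i)]]%SET =
      if class_set c == [set 1%g]%SET then finset.setT else finset.set0.
    apply/setP => a; rewrite inE class_set1; case: ifPn => c1; rewrite inE.
      by apply/forallP => i; rewrite (ord1 i).
    by apply/negbTE; apply: contra c1 => /forallP/(_ ord0).
  case: ifP => _; last by rewrite cards0 mul0r mulr0.
  by rewrite cardsT card_ffun card_ord expn1 -{1}[#|gT|]muln1 div_sqr_card mul1r mulr1.
move=> P a Pa i;
rewrite (@holonomy_boundary R gT (disc R) 1 (disc_bisection R) i ord0 ord0 P a)//.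
by rewrite mulVg.
Qed.

Local Notation i1 := (inord 1).

(** The end at 1 is parametrised through [circle_conj], which exchanges the halves; hence the words
    of the two ends are inverse up to conjugation. *)
Definition cylinder_hol (i : 'I_2) (a : {ffun 'I_2 -> gT}) : gT :=
  (if i == ord0 then (a i1)^-1 * a ord0 else a i1 * (a ord0)^-1)%g.

Lemma cylinder_holP (P : pbundle gT (cylinder R)) a :
  has_data (cylinder_bisection R) P a -> forall i : 'I_(nb_circles (cylinder R)),
  holonomy (circle_restriction i (restriction P)) =
    (cylinder_hol i a ^: [set: gT]%SET)%g.
Proof.
move=> Pa i; rewrite /cylinder_hol; have [i0|i0] := eqVneq i ord0.
  apply: (@holonomy_boundary R gT (cylinder R) 2 (cylinder_bisection R) i) Pa;
  by move=> z; rewrite i0.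
have cE (z : circle R) : (bcircle i z : cylinder_space R).1 = circle_conj z.
  by rewrite /bcircle/= /cylinder_circle (negbTE i0).
apply: (@holonomy_boundary_swap R gT (cylinder R) 2 (cylinder_bisection R) i) Pa => z.
- by rewrite /lower/= /cylinder_half/= cE /circle_half/= mulrN mulN1r opprK mul1r.
- by rewrite /upper/= /cylinder_half/= cE /circle_half/= mulrN mulN1r mul1r.
- by rewrite /arc/= /cylinder_arc/= cE.
- by rewrite /arc/= /cylinder_arc/= cE.
Qed.

Lemma metricE c d :
  metric R c d = (class_set c == [set x^-1%g | x in class_set d]%SET)%:R
                 * (#|class_set c|%:R / #|gT|%:R).
Proof.
rewrite /metric (Zindex_count (D := cylinder_bisection R) cylinder_holP).
rewrite -[[set _ | _ in _]%SET]/(class_set (class_inv d)) class_set_eq.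
(* Data are recoordinatised as (a_1, a_1^-1 a_0). The first coordinate is free and cancels one
   factor |G|; the second is the holonomy at one end, and at the other end it appears as a conjugate
   of its inverse. *)
pose F (u : gT * gT) : {ffun 'I_2 -> gT} := [ffun i => if i == ord0 then u.1 * u.2 else u.1]%g.
have F0 u : F u ord0 = (u.1 * u.2)%g by rewrite ffunE.
have F1 u : F u i1 = u.1.
  by rewrite ffunE inord1_eq0.
have Finj : injective F.
  move=> [g h] [g' h'] /ffunP e; have := e i1; have := e ord0; rewrite !F0 !F1/=.
  by move=> + gg; rewrite gg => /mulgI ->.
pose A := [set h in class_set c | c == class_inv d]%SET.
have -> : [set a | [forall i, cylinder_hol i a \in class_set (tnth [tuple c; d] i)]]%SET =
    (F @: finset.setX finset.setT A)%SET.
  apply/setP => a; rewrite inE; apply/forallP/imsetP => [h|[[g h] + ->]].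
    exists (a i1, (a i1)^-1 * a ord0)%g; last first.
      apply/ffunP => i; case: (ord2P i) => ->; rewrite ?F0 ?F1//= mulKVg//.
    rewrite !inE /=; have hc : ((a i1)^-1 * a ord0)%g \in class_set c by exact: (h ord0).
    rewrite hc/=; apply/eqP/(class_set_inj hc); rewrite mem_class_inv invMg invgK.
    rewrite -(class_setJ _ _ (a ord0)^-1)%g conjgE invgK !mulgA mulgV mul1g.
    by have := h i1; rewrite /cylinder_hol inord1_eq0 (tnth_nth c) /= inordK.
  rewrite !inE /= => /andP[hc /eqP cd] i.
  case: (ord2P i) => ->; rewrite /cylinder_hol ?eqxx ?F0 ?F1/=.
    by rewrite mulKg.
  rewrite inord1_eq0.
  have -> : tnth [tuple c; d] i1 = d by rewrite (tnth_nth c) /= inordK.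
  rewrite invMg -(class_setJ _ _ g) conjgE !mulgA mulVg mul1g mulgKV.
  by rewrite -mem_class_inv -cd.
rewrite card_imset// cardsX cardsT div_sqr_card mulrA; congr (_ / _).
rewrite -natrM; congr _%:R; rewrite /A; case: eqP => _; last first.
  by rewrite mul0n; apply: eq_card0 => x; rewrite !inE andbF.
by rewrite mul1n; apply: eq_card => x; rewrite !inE andbT.
Qed.

Local Notation k0 := (inord 0 : 'I_3).
Local Notation k1 := (inord 1 : 'I_3).
Local Notation k2 := (inord 2 : 'I_3).

(** Each circle meets the equator in the ends of two arcs; circle 0 is parametrised with the halves
    exchanged, whence its different shape. Conjugated by [a k0] its word becomes a_0^-1 a_2, and the
    three words then multiply to 1. *)
Definition trinion_hol (i : 'I_3) (a : {ffun 'I_3 -> gT}) : gT :=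
  (if i == 0%N :> nat then a k2 * (a k0)^-1
   else if i == 1%N :> nat then (a k2)^-1 * a k1 else (a k1)^-1 * a k0)%g.

Lemma trinion_holP (P : pbundle gT (trinion R)) a :
  has_data (trinion_bisection R) P a -> forall i : 'I_(nb_circles (trinion R)),
  holonomy (circle_restriction i (restriction P)) =
    (trinion_hol i a ^: [set: gT]%SET)%g.
Proof.
move=> Pa i; rewrite /trinion_hol.
pose onarc (k : 'I_3) (p : R * R * R) := p.2 = 0 /\
  if k == 0%N :> nat then 3 / 5 <= p.1.1 /\ 0 <= p.1.2
  else if k == 1%N :> nat then p.1.1 <= - (3 / 5) /\ 0 <= p.1.2
  else p.1.2 <= - (3 / 5).
have onarcP k (z : circle R) : onarc k (trinion_point i z) ->
  arc (trinion_bisection R) k (bcircle i z) by [].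
have onhalf b (z : circle R) : 0 <= sg R b * (trinion_point i z).2 ->
  trinion_half b (bcircle i z) by [].
have arc0 (z : circle R) : arc (circle_bisection R) ord0 z -> (\val z).1 = 1 /\ (\val z).2 = 0.
  by move=> z0; split; [exact: z0|exact: circle_arc_snd z0].
have arc1 (z : circle R) : arc (circle_bisection R) i1 z -> (\val z).1 = -1 /\ (\val z).2 = 0.
  move=> z1; split; last exact: circle_arc_snd z1.
  by rewrite [LHS]z1 /sg inord1_eq0.
case: ifPn => i0; [|case: ifPn => i1'].
- have pE (z : circle R) : trinion_point i z =
      (4 / 5, 3 / 5 * (\val z).1, - (3 / 5 * (\val z).2)) by rewrite /trinion_point i0.
  apply: (@holonomy_boundary_swap R gT (trinion R) 3 (trinion_bisection R) i) Pa => z.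
  + move=> h; have {}h : 0 <= sg R true * (\val z).2 := h.
    by apply: (onhalf false); move: h; rewrite pE /sg /= => h; lra.
  + move=> h; have {}h : 0 <= sg R false * (\val z).2 := h.
    by apply: (onhalf true); move: h; rewrite pE /sg /= => h; lra.
  + move=> /arc0[z1 z2]; apply: onarcP; rewrite /onarc pE /= inordK//= z1 z2.
    by split; [lra|split; lra].
  + move=> /arc1[z1 z2]; apply: onarcP; rewrite /onarc pE /= inordK//= z1 z2.
    by split; lra.
- have pE (z : circle R) : trinion_point i z =
      (- (4 / 5), 3 / 5 * (\val z).1, 3 / 5 * (\val z).2).
    by rewrite /trinion_point (negbTE i0) i1'.
  apply: (@holonomy_boundary R gT (trinion R) 3 (trinion_bisection R) i) Pa => z.
  + move=> h; have {}h : 0 <= sg R true * (\val z).2 := h.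
    by apply: (onhalf true); move: h; rewrite pE /sg /= => h; lra.
  + move=> h; have {}h : 0 <= sg R false * (\val z).2 := h.
    by apply: (onhalf false); move: h; rewrite pE /sg /= => h; lra.
  + move=> /arc0[z1 z2]; apply: onarcP; rewrite /onarc pE /= inordK//= z1 z2.
    by split; [lra|split; lra].
  + move=> /arc1[z1 z2]; apply: onarcP; rewrite /onarc pE /= inordK//= z1 z2.
    by split; lra.
- have pE (z : circle R) : trinion_point i z =
      (3 / 5 * (\val z).1, 4 / 5, 3 / 5 * (\val z).2).
    by rewrite /trinion_point (negbTE i0) (negbTE i1').
  apply: (@holonomy_boundary R gT (trinion R) 3 (trinion_bisection R) i) Pa => z.
  + move=> h; have {}h : 0 <= sg R true * (\val z).2 := h.
    by apply: (onhalf true); move: h; rewrite pE /sg /= => h; lra.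
  + move=> h; have {}h : 0 <= sg R false * (\val z).2 := h.
    by apply: (onhalf false); move: h; rewrite pE /sg /= => h; lra.
  + move=> /arc0[z1 z2]; apply: onarcP; rewrite /onarc pE /= inordK//= z1 z2.
    by split; [lra|split; lra].
  + move=> /arc1[z1 z2]; apply: onarcP; rewrite /onarc pE /= inordK//= z1 z2.
    by split; [lra|split; lra].
Qed.

Lemma Z3E c d e :
  Z3 R c d e = (#|gT|%:R)^-1 *
    #|[set u : gT * gT * gT |
        [&& u.1.1 \in class_set c, u.1.2 \in class_set d, u.2 \in class_set e
          & (u.1.1 * u.1.2 * u.2)%g == 1%g]]%SET|%:R.
Proof.
rewrite /Z3 (Zindex_count (D := trinion_bisection R) trinion_holP).
set U := [set u : gT * gT * gT | _]%SET.
(* F inverts the passage from a to a_0 together with the triple (a_0^-1 a_2, a_2^-1 a_1, a_1^-1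
   a_0); the free a_0 cancels one factor |G|. *)
pose F (v : gT * (gT * gT * gT)) : {ffun 'I_3 -> gT} :=
  [ffun i : 'I_3 => if i == 0%N :> nat then v.1
    else if i == 1%N :> nat then v.1 * v.2.1.1 * v.2.1.2 else v.1 * v.2.1.1]%g.
have F0 v : F v k0 = v.1 by rewrite ffunE inordK.
have F1 v : F v k1 = (v.1 * v.2.1.1 * v.2.1.2)%g by rewrite ffunE inordK.
have F2 v : F v k2 = (v.1 * v.2.1.1)%g by rewrite ffunE inordK.
have ord3P (i : 'I_3) : [\/ i = k0, i = k1 | i = k2].
  by case: i => [[|[|[|//]]] i3]; [constructor 1|constructor 2|constructor 3];
    apply: val_inj; rewrite /= inordK.
(* The third entry of the triple is recovered from the relation u1 u2 u3 = 1, which is why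
   injectivity is restricted to U. *)
have Finj : {in finset.setX finset.setT U &, injective F}.
  move=> [g [[u1 u2] u3]] [g' [[v1 v2] v3]]; rewrite !inE /=.
  move=> /and4P[_ _ _ /eqP pu] /and4P[_ _ _ /eqP pv] /ffunP E.
  have := E k0; have := E k1; have := E k2; rewrite !F0 !F1 !F2 /= => e2 + e0.
  move: e2; rewrite e0 -!mulgA => /mulgI e2; rewrite e2 => /mulgI /mulgI e1.
  by move: pu; rewrite e2 e1 -pv => /mulgI ->.
have -> : [set a | [forall i, trinion_hol i a \in class_set (tnth [tuple c; d; e] i)]]%SET =
    (F @: finset.setX finset.setT U)%SET.
  have t0 : tnth [tuple c; d; e] k0 = c by rewrite (tnth_nth c) /= inordK.
  have t1 : tnth [tuple c; d; e] k1 = d by rewrite (tnth_nth c) /= inordK.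
  have t2 : tnth [tuple c; d; e] k2 = e by rewrite (tnth_nth c) /= inordK.
  apply/setP => a; rewrite inE; apply/forallP/imsetP => [h|[[g [[u1 u2] u3]] + ->]].
    exists (a k0, ((a k0)^-1 * a k2, (a k2)^-1 * a k1, (a k1)^-1 * a k0))%g; last first.
      by apply/ffunP => i; have [->|->|->] := ord3P i; rewrite ?F0 ?F1 ?F2 /= ?mulKVg.
    rewrite !inE /=; apply/and4P; split.
    - have := h k0; rewrite t0 /trinion_hol inordK//= -(class_setJ _ _ (a k0)).
      by rewrite conjgE mulgKV.
    - by have := h k1; rewrite t1 /trinion_hol inordK.
    - by have := h k2; rewrite t2 /trinion_hol inordK.
    - by rewrite -!mulgA mulKVg mulKVg mulVg.
  rewrite !inE /= => /and4P[uc ud ue /eqP pu] i.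
  have [->|->|->] := ord3P i; rewrite /trinion_hol ?t0 ?t1 ?t2 inordK//= ?F0 ?F1 ?F2/=.
  - by rewrite -(class_setJ _ _ g) conjgE mulgKV mulKg.
  - by rewrite mulKg.
  - have <- : u3 = ((g * u1 * u2)^-1 * g)%g; last by [].
    by apply: (@mulgI _ (u1 * u2)%g); rewrite pu !invMg !mulgA mulgKV mulgK mulgV.
rewrite card_in_imset// cardsX cardsT div_sqr_card mulrC; congr (_ * _).
Qed.

End SurfaceValues.

(** * The Frobenius algebra of the circle *)

Section CircleSpace.
Variables (R : realType) (gT : finGroupType).
Local Notation C := R[i].
Implicit Types (c d e : conj_class gT) (P : pbundle gT (circle R)) (f : class_fun R gT).

Lemma holonomy_class P : exists c, holonomy P = class_set c.
Proof.
have [a Pa] := has_data_exists (circle_bisection R) P.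
by exists (class_of (hol a)); rewrite (holonomy_data Pa).
Qed.

Lemma holonomy_realised c : exists P, holonomy P = class_set c.
Proof.
have [x xc] := class_set_ex c.
pose a : {ffun 'I_2 -> gT} := [ffun i => if i == ord0 then x else 1%g].
have [P Pa] := has_data_realised (circle_bisection R) a; exists P.
rewrite (holonomy_data Pa) /hol !ffunE /= inord1_eq0 invg1 mul1g.
exact/class_set_eqP.
Qed.

Lemma class_fun_eq f c x y : x \in class_set c -> y \in class_set c -> f x = f y.
Proof.
move=> /class_set_eqP <- /imsetP[z _ ->]; exact/esym/class_funJ.
Qed.

Lemma ZofE f P x : x \in holonomy P -> Zof f P = f x.
Proof.
have [c hc] := holonomy_class P; rewrite /Zof hc => xc.
by apply: (@class_fun_eq f c) => //; exact: mem_repr xc.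
Qed.

Lemma Zspace_holonomy (phi : pbundle gT (circle R) -> C) P P' :
  Zspace phi -> holonomy P = holonomy P' -> phi P = phi P'.
Proof. by move=> phiZ h; apply: phiZ; exact/isomorphic_holonomy. Qed.

Lemma Zspace_Zof f : Zspace (Zof f).
Proof. by move=> P P' /isomorphic_holonomy h; rewrite /Zof h. Qed.

Lemma Zspace_Ze (A : {set gT}) : Zspace (Ze A : pbundle gT (circle R) -> C).
Proof. by move=> P P' /isomorphic_holonomy h; rewrite /Ze h. Qed.

Lemma coordE (phi : pbundle gT (circle R) -> C) c P :
  Zspace phi -> holonomy P = class_set c -> coord phi c = phi P.
Proof.
move=> phiZ hP; apply: xget_unique; first by exists P.
by move=> _ [P' [hP' ->]]; apply: Zspace_holonomy => //; rewrite hP.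
Qed.

Lemma coord_Zof f c x : x \in class_set c -> coord (Zof f) c = f x.
Proof.
have [P hP] := holonomy_realised c => xc.
by rewrite (coordE (@Zspace_Zof f) hP) (ZofE f (x := x))// hP.
Qed.

Lemma coord_Ze c d : coord (@Ze R gT (class_set c)) d = (d == c)%:R.
Proof.
have [P hP] := holonomy_realised d.
by rewrite (coordE (Zspace_Ze (class_set c)) hP) /Ze hP class_set_eq.
Qed.

Lemma sum_delta (T : finType) (F : T -> C) (c : T) : \sum_d F d * (d == c)%:R = F c.
Proof.
rewrite (bigD1 c)//= eqxx mulr1 big1 ?addr0// => d /negbTE ->.
by rewrite mulr0.
Qed.

Lemma sum_Ze (F : conj_class gT -> C) P c : holonomy P = class_set c ->
  \sum_d F d * Ze (class_set d) P = F c.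
Proof.
move=> hP; rewrite -[RHS](sum_delta F); apply: eq_bigr => d _.
by rewrite /Ze hP class_set_eq eq_sym.
Qed.

Lemma sum_coord_Zof f x : \sum_c coord (Zof f) c * (x \in class_set c)%:R = f x.
Proof.
rewrite -(coord_Zof f (mem_class_of x)) -[RHS](sum_delta (coord (Zof f))).
apply: eq_bigr => c _; rewrite (class_set_eq_sym _ (mem_class_of x)).
by rewrite eq_sym.
Qed.

Lemma Zof_indicator c P : Zof (cf_indicator R c) P = Ze (class_set c) P.
Proof.
have [d hd] := holonomy_class P; have [x xd] := class_set_ex d.
rewrite (ZofE _ (x := x)) ?hd// ffunE /Ze hd class_set_eq.
by rewrite (class_set_eq_sym c xd).
Qed.

Lemma card_class_neq0 c : #|class_set c|%:R != 0 :> C.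
Proof. by rewrite pnatr_eq0 -lt0n card_class_gt0. Qed.

Lemma metric_delta c d :
  metric R c d = (c == class_inv d)%:R * (#|class_set c|%:R / #|gT|%:R).
Proof.
rewrite metricE -[[set _ | _ in _]%SET]/(class_set (class_inv d)).
by rewrite class_set_eq.
Qed.

(** The metric is a weighted permutation matrix for c |-> c^-1, so its inverse has the same support
    and reciprocal weights; |c^-1| = |c| matches them. *)
Lemma inv_metricE c d :
  inv_metric R c d = (c == class_inv d)%:R * (#|gT|%:R / #|class_set c|%:R).
Proof.
pose W : 'M[C]_#|{: conj_class gT}| := \matrix_(i, j)
  ((enum_val i == class_inv (enum_val j))%:R * (#|gT|%:R / #|class_set (enum_val i)|%:R)).
have MW : metric_mx R gT *m W = 1%:M.
  apply/matrixP => i j; rewrite !mxE.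
  transitivity (\sum_(k : conj_class gT) (metric R (enum_val i) k *
      (#|gT|%:R / #|class_set k|%:R)) * (k == class_inv (enum_val j))%:R).
    rewrite [RHS](reindex (@enum_val (conj_class gT) {: conj_class gT}));
      last exact: onW_bij (@enum_val_bij _).
    by apply: eq_bigr => k _; rewrite !mxE -[in RHS]mulrA [in RHS](mulrC (_ / _)).
  rewrite sum_delta metric_delta class_invK (inj_eq enum_val_inj) card_class_inv.
  have [->|_] := eqVneq i j; last by rewrite !mul0r.
  rewrite mul1r mulrA mulfVK ?natr_card_neq0//.
  by rewrite divff// card_class_neq0.
have [Mu _] := mulmx1_unit MW.
rewrite /inv_metric; have -> : invmx (metric_mx R gT) = W.
  by rewrite -[W]mul1mx -(mulVmx Mu) -mulmxA MW mulmx1.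
by rewrite mxE !enum_rankK.
Qed.

Lemma sum_inv_metric (F : conj_class gT -> C) c :
  \sum_k inv_metric R k c * F k = #|gT|%:R / #|class_set c|%:R * F (class_inv c).
Proof.
rewrite -[#|class_set c|]card_class_inv.
rewrite -(sum_delta (fun k => #|gT|%:R / #|class_set k|%:R * F k)).
by apply: eq_bigr => k _; rewrite inv_metricE [RHS]mulrC [RHS]mulrA.
Qed.

Lemma Z1_raisedE c : Z1_raised R c = (class_set c == [set 1%g]%SET)%:R.
Proof.
rewrite /Z1_raised sum_inv_metric Z1E !class_set1 mem_class_inv invg1.
case: (boolP (1%g \in class_set c)) => c1; last by rewrite !mulr0.
move: c1; rewrite -class_set1 => /eqP ->; rewrite cards1 divr1 mulr1 mulfV//.
exact: natr_card_neq0.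
Qed.

Definition factorisations c d (g : gT) : {set gT} :=
  [set h in class_set d | (g * h^-1)%g \in class_set c]%SET.

Lemma card_factorisations c d e g g' : g \in class_set e -> g' \in class_set e ->
  #|factorisations c d g| = #|factorisations c d g'|.
Proof.
move=> /class_set_eqP <- /imsetP[y _ ->].
rewrite -(card_imset _ (conjg_inj y)); apply: eq_card => h.
apply/imsetP/idP => [[k + ->]|].
  by rewrite !inE class_setJ -conjVg -conjMg class_setJ.
rewrite inE => /andP[hd gh]; exists (h ^ y^-1)%g; last by rewrite conjgKV.
by rewrite inE class_setJ hd /= -(class_setJ _ _ y) conjMg conjVg conjgKV.
Qed.

(** A triple corresponds to x = u3^-1 in e and a factorisation of x with second factor h = u2. By
    conjugation the number of factorisations is the same for all x in e, and the resulting factor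
    |e| is what the inverse metric cancels. *)
Lemma card_triples c d e g : g \in class_set e ->
  #|[set u : gT * gT * gT |
     [&& u.1.1 \in class_set c, u.1.2 \in class_set d, u.2 \in class_set (class_inv e)
       & (u.1.1 * u.1.2 * u.2)%g == 1%g]]%SET| =
  (#|class_set e| * #|factorisations c d g|)%N.
Proof.
move=> ge; pose S := [set v : gT * gT |
  (v.1 \in class_set e) && (v.2 \in factorisations c d v.1)]%SET.
pose F (v : gT * gT) := (v.1 * v.2^-1, v.2, v.1^-1)%g.
have Finj : injective F by move=> [x h] [x' h'] [_ -> /invg_inj ->].
transitivity #|S|.
  rewrite -(card_imset _ Finj); apply: eq_card => -[[u1 u2] u3].
  rewrite inE mem_class_inv /=; apply/and4P/imsetP.
    move=> [u1c u2d u3e /eqP u123].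
    have u3E : u3^-1%g = (u1 * u2)%g by apply: (@mulIg _ u3); rewrite mulVg u123.
    exists (u1 * u2, u2)%g; last by rewrite /F /= mulgK -u3E invgK.
    by rewrite !inE /= -u3E u3E mulgK u1c u2d -u3E u3e.
  move=> [[x h]]; rewrite !inE /= => /andP[xe /andP[hd xh]] [-> -> ->].
  by rewrite invgK mulgKV mulgV.
rewrite -sum1_card (eq_bigl (fun v =>
  (v.1 \in class_set e) && (v.2 \in factorisations c d v.1))); last first.
  by move=> v; rewrite inE.
rewrite -(pair_big_dep (mem (class_set e)) (fun x h => h \in factorisations c d x)
  (fun _ _ => 1%N)) /=.
rewrite -sum_nat_const; apply: eq_bigr => x xe.
by rewrite sum1_card; exact: card_factorisations xe ge.
Qed.

Lemma Z3_raisedE c d e g : g \in class_set e ->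
  Z3_raised R c d e = #|factorisations c d g|%:R.
Proof.
move=> ge; rewrite /Z3_raised sum_inv_metric Z3E (card_triples _ _ ge) natrM.
rewrite mulrA [X in X * _]mulrAC divff ?natr_card_neq0// mul1r mulrA.
by rewrite mulVf ?mul1r// card_class_neq0.
Qed.

Lemma Zone_E P : Zone P = Ze [set 1%g]%SET P :> C.
Proof.
have [c hP] := holonomy_class P.
by rewrite /Zone (sum_Ze (Z1_raised R (gT := gT)) hP) Z1_raisedE /Ze hP.
Qed.

Lemma Zform_Zof f : Zform (Zof f) = cf_form f.
Proof.
rewrite /Zform /cf_form -(sum_coord_Zof f 1%g) mulr_sumr.
by apply: eq_bigr => c _; rewrite Z1E class_set1 mulrCA.
Qed.

Lemma Zmul_Ze c d P :
  Zmul (Ze (class_set c)) (Ze (class_set d)) P =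
  \sum_e Z3_raised R c d e * Ze (class_set e) P.
Proof.
rewrite /Zmul (bigD1 c)//= [X in _ + X]big1 ?addr0 => [|c' /negbTE c'c]; last first.
  by do 2!(apply: big1 => ? _); rewrite coord_Ze c'c !mul0r.
rewrite (bigD1 d)//= [X in _ + X]big1 ?addr0 => [|d' /negbTE d'd]; last first.
  by apply: big1 => ? _; rewrite !coord_Ze d'd mulr0 !mul0r.
by apply: eq_bigr => e _; rewrite !coord_Ze !eqxx !mul1r.
Qed.

Lemma Zof_conv f f' P : Zof (cf_conv f f') P = Zmul (Zof f) (Zof f') P.
Proof.
have [e hP] := holonomy_class P; have [g ge] := class_set_ex e.
rewrite (ZofE _ (x := g)) ?hP// ffunE /Zmul.
under [RHS]eq_bigr do under eq_bigr do rewrite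
  (sum_Ze (fun e => coord (Zof f) _ * coord (Zof f') _ * Z3_raised R _ _ e) hP)
  (Z3_raisedE _ _ ge).
have inj : injective (fun h : gT => (g * h^-1)%g) by move=> h h' /mulgI /invg_inj.
(* Substituting g h^-1 for h turns the convolution into the sum of f(g h^-1) f'(h), whose terms with
   h in d and g h^-1 in c are the factorisations counted by [Z3_raised]. *)
rewrite (reindex_inj inj) /=.
under [RHS]eq_bigr => c _ do under eq_bigr => d _ do
  rewrite -sum1_card natr_sum mulr_sumr big_mkcond /=.
under [RHS]eq_bigr do rewrite exchange_big /=.
rewrite [RHS]exchange_big /=; apply: eq_bigr => h _.
rewrite -(sum_coord_Zof f (g * h^-1)%g) mulr_suml; apply: eq_bigr => c _.
have -> : f' ((g * h^-1)^-1 * g)%g = f' h by rewrite invMg invgK mulgKV.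
rewrite -(sum_coord_Zof f' h) mulr_sumr; apply: eq_bigr => d _.
rewrite inE; case: (h \in _); case: (_ \in class_set c) => /=;
  by rewrite ?mulr1 ?mulr0 ?mul0r.
Qed.

End CircleSpace.

(** * The Frobenius algebra of class functions *)

Section ConvolutionAlgebra.
Variables (R : realType) (gT : finGroupType).
Local Notation C := R[i].
Local Notation cfun := (class_fun R gT).
Implicit Types (f : cfun) (c : conj_class gT).

Lemma class_fun_ext f f' : (forall x, f x = f' x) -> f = f'.
Proof. by move=> ff'; apply: val_inj; apply/ffunP. Qed.

Lemma class_fun_linE (k : C) f f' x : (k *: f + f') x = k * f x + f' x.
Proof. by rewrite !ffunE. Qed.

Lemma cf_convE f f' g : cf_conv f f' g = \sum_(h : gT) f h * f' (h^-1 * g)%g.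
Proof. by rewrite ffunE. Qed.

Lemma cf_indicatorE c x : cf_indicator R c x = (x \in class_set c)%:R.
Proof. by rewrite ffunE. Qed.

Lemma class_fun_sum (n : nat) (F : 'I_n -> cfun) x : (\sum_i F i) x = \sum_i F i x.
Proof.
elim/big_ind2: _ => [|f a f' b <- <-|//]; first by rewrite ffunE.
by rewrite ffunE.
Qed.

Lemma cf_conv_Frobenius :
  Frobenius_algebra (@cf_conv R gT) (cf_indicator R (class1 gT)) (@cf_form R gT).
Proof.
split.
- split=> a x y z; apply: class_fun_ext => g; rewrite class_fun_linE !cf_convE
    mulr_sumr -big_split /=; apply: eq_bigr => h _; rewrite class_fun_linE.
    by rewrite mulrDl mulrA.
  by rewrite mulrDr mulrCA.
- split; [|split].
  + move=> x y z; apply: class_fun_ext => g; rewrite !cf_convE.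
    under eq_bigr do rewrite cf_convE mulr_sumr.
    under [RHS]eq_bigr do rewrite cf_convE mulr_suml.
    rewrite [RHS]exchange_big /=; apply: eq_bigr => h _.
    rewrite [RHS](reindex_inj (mulgI h)) /=; apply: eq_bigr => k _.
    by rewrite mulKg invMg -!mulgA mulrA.
  + move=> x; apply: class_fun_ext => g; rewrite cf_convE (bigD1 1%g)//= big1.
      by rewrite cf_indicatorE finset.in_set1 eqxx invg1 mul1g mul1r addr0.
    by move=> h h1; rewrite cf_indicatorE finset.in_set1 (negbTE h1) mul0r.
  + move=> x; apply: class_fun_ext => g; rewrite cf_convE (bigD1 g)//= big1.
      by rewrite cf_indicatorE finset.in_set1 mulVg eqxx mulr1 addr0.
    move=> h hg; rewrite cf_indicatorE finset.in_set1 -eq_invg_mul invgK.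
    by rewrite (negbTE hg) mulr0.
- by move=> a x y; rewrite /cf_form class_fun_linE mulrDr mulrCA.
- exists #|{: conj_class gT}|, (fun i => cf_indicator R (enum_val i)) => x.
  exists (fun i => coord (Zof x) (enum_val i)); apply: class_fun_ext => g.
  rewrite class_fun_sum -[LHS]sum_coord_Zof.
  rewrite [LHS](reindex (@enum_val (conj_class gT) {: conj_class gT})); last first.
    exact: onW_bij (@enum_val_bij _).
  by apply: eq_bigr => i _; rewrite ffunE cf_indicatorE.
- move=> x x0; apply: class_fun_ext => g; pose c := class_of g.
  (* Pairing with the indicator of the inverse class isolates the value at g: the form equals x(g)
     |c| / |G|. *)
  have := x0 (cf_indicator R (class_inv c)); rewrite /cf_form cf_convE.
  have -> : \sum_h x h * cf_indicator R (class_inv c) (h^-1 * 1)%g =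
      #|class_set c|%:R * x g.
    rewrite mulr_natl -sumr_const [RHS]big_mkcond /=; apply: eq_bigr => h _.
    rewrite mulg1 cf_indicatorE mem_class_inv invgK; case: ifP => hc.
      by rewrite mulr1; exact: class_fun_eq hc (mem_class_of g).
    by rewrite mulr0.
  move/eqP; rewrite !mulf_eq0 invr_eq0 (negbTE (natr_card_neq0 R gT)).
  by rewrite (negbTE (card_class_neq0 R c)) /= => /eqP ->; rewrite ffunE.
Qed.

(** An invariant function depends only on the holonomy class, which gives existence; every class is
    the holonomy of some bundle, which gives uniqueness. *)
Lemma Zspace_class_fun (phi : pbundle gT (circle R) -> C) : Zspace phi ->
  exists! f : cfun, forall P, phi P = Zof f P.
Proof.
move=> phiZ.
have cf_phi : [ffun x => coord phi (class_of x) : C^o] \in @class_functions R gT.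
  apply/class_functionP => x y; rewrite !ffunE; congr coord.
  apply: (@class_set_inj _ _ _ x); last exact: mem_class_of.
  by rewrite -(class_setJ _ x y); exact: mem_class_of.
exists (ClassFun cf_phi); split.
  move=> P; have [c hP] := holonomy_class P; have [x xc] := class_set_ex c.
  rewrite (ZofE _ (x := x)) ?hP// ffunE (coordE phiZ (P := P))// hP.
  by rewrite (class_set_inj xc (mem_class_of x)).
move=> f fphi; apply: class_fun_ext => x; rewrite ffunE.
have [P hP] := holonomy_realised R (class_of x).
by rewrite (coordE phiZ hP) fphi (ZofE _ (x := x))// hP mem_class_of.
Qed.

Lemma Zspace_basis (phi : pbundle gT (circle R) -> C) : Zspace phi ->
  exists! k : {ffun conj_class gT -> C},
    forall P, phi P = \sum_(c : conj_class gT) k c * Ze (class_set c) P.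
Proof.
move=> phiZ; exists [ffun c => coord phi c]; split=> [P|k kphi].
  have [c hP] := holonomy_class P.
  by rewrite (sum_Ze _ hP) ffunE (coordE phiZ hP).
apply/ffunP => c; rewrite ffunE; have [P hP] := holonomy_realised R c.
by rewrite (coordE phiZ hP) kphi (sum_Ze _ hP).
Qed.

End ConvolutionAlgebra.

Theorem mainTheorem4 (R : realType) (gT : finGroupType) :
  (* Z(S^1) is the space of class functions, with basis the e_alpha *)
  ([/\ forall f : class_fun R gT, Zspace (Zof f),
       forall phi : pbundle gT (circle R) -> R[i], Zspace phi ->
         exists! f : class_fun R gT, forall P, phi P = Zof f P,
       forall (f : class_fun R gT) P g, has_holonomy P g -> Zof f P = f g &
       forall (k : R[i]) (f f' : class_fun R gT) P,
         Zof (k *: f + f') P = k * Zof f P + Zof f' P]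
   /\
   [/\ forall (a : conj_class gT) (P : pbundle gT (circle R)),
         Zof (cf_indicator R a) P = Ze (class_set a) P,
       forall a : conj_class gT, Zspace (@Ze R gT (class_set a)) &
       forall phi : pbundle gT (circle R) -> R[i], Zspace phi ->
         exists! c : {ffun conj_class gT -> R[i]},
           forall P, phi P = \sum_(a : conj_class gT) c a * Ze (class_set a) P])
  /\
  (* (i) *)
  (forall a b : conj_class gT,
     metric R a b = (class_set a == [set x^-1%g | x in class_set b]%SET)%:R
                    * (#|class_set a|%:R / #|gT|%:R))
  /\
  (* (ii) *)
  [/\ forall a b c : conj_class gT,
        Z3 R a b c =
          (#|gT|%:R)^-1 *
          #|[set u : gT * gT * gT |
             [&& u.1.1 \in class_set a, u.1.2 \in class_set b, u.2 \in class_set c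
               & (u.1.1 * u.1.2 * u.2)%g == 1%g]]%SET|%:R,
      forall (a b : conj_class gT) (P : pbundle gT (circle R)),
        Zmul (Ze (class_set a)) (Ze (class_set b)) P =
          \sum_(c : conj_class gT) Z3_raised R a b c * Ze (class_set c) P &
      forall (a b c : conj_class gT) (g : gT), g \in class_set c ->
        Z3_raised R a b c =
          #|[set h in class_set b | (g * h^-1)%g \in class_set a]%SET|%:R]
  /\
  (* (iii) *)
  ((forall P : pbundle gT (circle R), Zone P = Ze [set 1%g]%SET P) /\
   (forall a : conj_class gT,
      Zform (@Ze R gT (class_set a)) =
        (#|gT|%:R)^-1 * (class_set a == [set 1%g]%SET)%:R))
  /\
  (* the Frobenius algebra structures agree *)
  [/\ Frobenius_algebra (@cf_conv R gT) (cf_indicator R (class1 gT))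
        (@cf_form R gT),
      forall (f f' : class_fun R gT) P,
        Zof (cf_conv f f') P = Zmul (Zof f) (Zof f') P,
      forall P : pbundle gT (circle R),
        Zof (cf_indicator R (class1 gT)) P = Zone P &
      forall f : class_fun R gT, Zform (Zof f) = cf_form f].
Proof.
split; [split|split; [|split; [|split]]].
- split; [exact: Zspace_Zof|exact: Zspace_class_fun| |].
    by move=> f P g Pg; apply: ZofE; rewrite inE; exact/asboolP.
  by move=> k f f' P; exact: class_fun_linE.
- split; [exact: Zof_indicator|by move=> a; exact: Zspace_Ze|exact: Zspace_basis].
- exact: metricE.
- by split; [exact: Z3E|exact: Zmul_Ze|exact: Z3_raisedE].
- split; [exact: Zone_E|move=> a].
  transitivity (Zform (Zof (cf_indicator R a))).
    by congr Zform; apply/funext => P; rewrite Zof_indicator.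
  by rewrite Zform_Zof /cf_form cf_indicatorE class_set1.
- split; [exact: cf_conv_Frobenius|exact: Zof_conv| |exact: Zform_Zof].
  move=> P; rewrite Zof_indicator Zone_E; congr (Ze _ P).
Qed.
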